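(* Let $s>2$ be an integer and let $M$ be an unstable $\mathscr{A}$-module. Then the morphism $$R_s M \longrightarrow \mathbb{F}_2\otimes_{\mathscr{A}}(P_s\otimes M),$$ given by the inclusion $R_sM\subset P_s\otimes M$ followed by the projection onto $\mathscr{A}$-indecomposables, is trivial on elements of positive degree.
   Context: $\mathbb{F}_2$ is the field with two elements, $\mathscr{A}$ is the mod $2$ Steenrod algebra and tensor products without subscript are over $\mathbb{F}_2$, with the diagonal $\mathscr{A}$-action (Cartan formula). For an $\mathscr{A}$-module $N$, $\mathbb{F}_2\otimes_{\mathscr{A}}N=N/\overline{\mathscr{A}}N$, where $\overline{\mathscr{A}}$ is the augmentation ideal. $P_s=\mathbb{F}_2[x_1,\dots,x_s]$ with $|x_i|=1$ and its canonical unstable algebra structure over $\mathscr{A}$ (so $P_s\cong H^*(B(\mathbb{Z}/2)^{\oplus s};\mathbb{F}_2)$). The Dickson algebra is $D_s=P_s^{GL_s(\mathbb{F}_2)}$. Total Steenrod power: for an unstable module $M$, $\mathrm{St}_1:M\to P_1\otimes M$ is the linear map with $\mathrm{St}_1(x)=\sum_i u^{|x|-i}\otimes Sq^i x$ for homogeneous $x$, where $P_1=\mathbb{F}_2[u]$. Recursively $\mathrm{St}_s=\mathrm{St}_1\circ \mathrm{St}_{s-1}:M\to P_s\otimes M$, meaning that $\mathrm{St}_1$ for the unstable module $P_{s-1}\otimes M$ is applied to $\mathrm{St}_{s-1}(x)$, using $P_1\otimes P_{s-1}\cong P_s$ ($\mathrm{St}_0=\mathrm{id}$). It is $\mathbb{F}_2$-linear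 (not $\mathscr{A}$-linear in general), multiplies degrees by $2^s$, and takes values in $D_s\otimes M$. Singer construction: $R_sM\subset P_s\otimes M$ is the $D_s$-submodule generated by the image of $\mathrm{St}_s$; it is an $\mathscr{A}$-submodule of $P_s\otimes M$ contained in $D_s\otimes M$. *)

(* Defs.v *)
From HB Require Import structures.
From mathcomp Require Import all_boot all_order all_algebra.
From mathcomp Require Import boolp.
From mathcomp Require Import freeg mpoly.

Set Implicit Arguments.
Unset Strict Implicit.
Unset Printing Implicit Defensive.

Import GRing.Theory.
Local Open Scope ring_scope.
Local Open Scope quotient_scope.

Lemma linear_at0 (R : pzRingType) (V W : lmodType R) (f : V -> W) :
  linear f -> f 0 = 0.
Proof. by move=> /(_ (-1) 0 0); rewrite scaler0 addr0 scaleN1r addNr. Qed.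

Section SpanQuotient.
Context (R : comNzRingType) (V : lmodType R) (G : V -> Prop).

Definition span : {pred V} := fun v =>
  `[< exists r : seq (R * V),
        (forall x, x \in r -> G x.2) /\ v = \sum_(x <- r) x.1 *: x.2 >].

Lemma span_submod_closed : submod_closed span.
Proof.
split; first by apply/asboolP; exists [::]; rewrite big_nil.
move=> a u v /asboolP[r [rG ->]] /asboolP[t [tG ->]]; apply/asboolP.
exists ([seq (a * x.1, x.2) | x <- r] ++ t); split.
  by move=> x; rewrite mem_cat => /orP[/mapP[y /rG ? ->]|/tG].
rewrite big_cat big_map scaler_sumr; congr (_ + _).
by apply: eq_bigr => x _; rewrite scalerA.
Qed.

HB.instance Definition _ := GRing.isSubmodClosed.Build R V span
  span_submod_closed.

Lemma mem_span v : G v -> v \in span.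
Proof.
move=> Gv; apply/asboolP; exists [:: (1, v)]; split.
  by move=> x; rewrite inE => /eqP ->.
by rewrite big_seq1 scale1r.
Qed.

Definition quotspan := Quotient.quot span.

HB.instance Definition _ := GRing.Zmodule.on quotspan.

Definition quot_pi (v : V) : quotspan := \pi_quotspan v.

Lemma quot_piE u v : (quot_pi u == quot_pi v) = (u - v \in span).
Proof. by rewrite /quot_pi /quotspan Quotient.idealrBE. Qed.

Lemma quot_pi_repr (q : quotspan) : quot_pi (repr q) = q.
Proof. exact: reprK. Qed.

Lemma quot_pi_is_zmod_morphism : zmod_morphism quot_pi.
Proof. by move=> u v; rewrite /quot_pi /quotspan !raddfB. Qed.

HB.instance Definition _ := GRing.isZmodMorphism.Build V quotspan quot_pi
  quot_pi_is_zmod_morphism.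

Definition quot_scale (a : R) (q : quotspan) : quotspan :=
  quot_pi (a *: repr q).

Lemma quot_scale_pi a v : quot_scale a (quot_pi v) = quot_pi (a *: v).
Proof.
apply/eqP; rewrite quot_piE -scalerBr rpredZ // -quot_piE.
by rewrite quot_pi_repr.
Qed.

Lemma quot_scaleA a b q : quot_scale a (quot_scale b q) = quot_scale (a * b) q.
Proof. by rewrite -[q]quot_pi_repr !quot_scale_pi scalerA. Qed.

Lemma quot_scale1 : left_id 1 quot_scale.
Proof. by move=> q; rewrite -[q]quot_pi_repr quot_scale_pi scale1r. Qed.

Lemma quot_scaleDr : right_distributive quot_scale +%R.
Proof.
move=> a p q; rewrite -[p]quot_pi_repr -[q]quot_pi_repr -raddfD.
by rewrite !quot_scale_pi -raddfD scalerDr.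
Qed.

Lemma quot_scaleDl q : {morph quot_scale^~ q : a b / a + b}.
Proof.
by move=> a b; rewrite -[q]quot_pi_repr !quot_scale_pi -raddfD scalerDl.
Qed.

HB.instance Definition _ := GRing.Zmodule_isLmodule.Build R quotspan
  quot_scaleA quot_scale1 quot_scaleDr quot_scaleDl.

Lemma quot_pi_is_scalable : scalable quot_pi.
Proof. by move=> a v; rewrite -quot_scale_pi. Qed.

HB.instance Definition _ := GRing.isScalable.Build R V quotspan *:%R quot_pi
  quot_pi_is_scalable.

End SpanQuotient.

Section Tensor.
Context (R : comNzRingType) (V W : lmodType R).

Definition tensor_rel (d : {freeg (V * W)%type / R}) : Prop :=
  (exists a v v' w,
     d = << (a *: v + v', w) >> - (a *: << (v, w) >> + << (v', w) >>)) \/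
  (exists a v w w',
     d = << (v, a *: w + w') >> - (a *: << (v, w) >> + << (v, w') >>)).

Definition tensor := quotspan tensor_rel.

HB.instance Definition _ := GRing.Lmodule.on tensor.

Definition tpure (v : V) (w : W) : tensor := quot_pi tensor_rel << (v, w) >>.

Context (U : lmodType R).

Definition is_bilinear (f : V -> W -> U) : Prop :=
  (forall w, linear (f^~ w)) /\ (forall v, linear (f v)).

(* The linear map V ⊗ W -> U induced by f; meaningful only for bilinear f,
   in which case it is computed by tliftE and tlift_linear. *)
Definition tlift (f : V -> W -> U) (t : tensor) : U :=
  fglift (fun vw => f vw.1 vw.2) (repr t).

End Tensor.

Notation "V ⊗ W" := (tensor V W) (at level 40, left associativity).
Notation "v *t w" := (tpure v w) (at level 40, left associativity).

Section TensorTheory.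
Context (R : comNzRingType) (V W U : lmodType R).

HB.instance Definition _ (K : choiceType) (f : K -> U) :=
  GRing.isZmodMorphism.Build {freeg K / R} U (fglift f)
    (@lift_is_additive R K U f).

Lemma fglift_is_linear (K : choiceType) (f : K -> U) :
  linear (fglift f : {freeg K / R} -> U).
Proof.
have fZ a (D : {freeg K / R}) : fglift f (a *: D) = a *: fglift f D.
  transitivity (fglift f (\sum_(z <- dom D) << a * coeff z D *g z >>)).
    by [].
  rewrite -[D in RHS]freeg_sumE !raddf_sum.
  by apply: eq_bigr => x _ /=; rewrite !liftU scalerA.
by move=> a D D'; rewrite raddfD /= fZ.
Qed.

HB.instance Definition _ (K : choiceType) (f : K -> U) :=
  GRing.isLinear.Build R {freeg K / R} U *:%R (fglift f) (fglift_is_linear f).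

Lemma tlift_pi (f : V -> W -> U) (d : {freeg (V * W)%type / R}) :
  is_bilinear f ->
  tlift f (quot_pi (tensor_rel (W:=W)) d) = fglift (fun vw => f vw.1 vw.2) d.
Proof.
case=> fl fr; set g := fun _ => _.
have F0 x : x \in span (@tensor_rel R V W) -> fglift g x = 0.
  case/asboolP=> r [rG ->]; rewrite linear_sum big_seq big1 // => y /rG.
  rewrite linearZ /=; set z := y.2 => zG.
  suff -> : fglift g z = 0 by rewrite scaler0.
  case: zG => [[a [v [v' [w ->]]]]|[a [v [w [w' ->]]]]];
  rewrite linearB linearP /= !liftU /g /= !scale1r.
    by rewrite fl subrr.
  by rewrite fr subrr.
rewrite /tlift -/g; apply/subr0_eq.
have := F0 (repr (quot_pi (tensor_rel (W:=W)) d) - d); rewrite linearB; apply.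
by rewrite -quot_piE quot_pi_repr.
Qed.

Lemma tliftE (f : V -> W -> U) v w : is_bilinear f -> tlift f (v *t w) = f v w.
Proof. by move=> fb; rewrite tlift_pi // liftU scale1r. Qed.

Lemma tlift_linear (f : V -> W -> U) : is_bilinear f -> linear (tlift f).
Proof.
move=> fb a t t'; rewrite -[t]quot_pi_repr -[t']quot_pi_repr -linearP.
by rewrite !tlift_pi // fglift_is_linear.
Qed.

Lemma tpure_bilinear : is_bilinear (@tpure R V W).
Proof.
split=> [w a v v'|v a w w']; rewrite /tpure -linearP; apply/eqP;
  rewrite quot_piE; apply: mem_span; [left|right].
  by exists a, v, v', w.
by exists a, v, w, w'.
Qed.

Lemma tensor_ind (P : V ⊗ W -> Prop) :
  P 0 -> (forall v w, P (v *t w)) ->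
  (forall a t t', P t -> P t' -> P (a *: t + t')) -> forall t, P t.
Proof.
move=> P0 Pp PD t; rewrite -[t]quot_pi_repr -[repr t]freeg_sumE.
rewrite linear_sum; apply: (@big_ind _ P) => //.
  by move=> x y Px Py; rewrite -[x]scale1r; exact: PD.
move=> [v w] _; set c := coeff _ _.
have -> : << c *g (v, w) >> = c *: << (v, w) >> + 0 :> {freeg (V * W)%type / R}.
  by rewrite addr0; apply/eqP/freeg_eqP => y; rewrite coeffZ !coeffU mul1r.
rewrite linearP linear0; apply: PD; [exact: Pp|exact: P0].
Qed.

Lemma tensor_linear_eq (f g : V ⊗ W -> U) :
  linear f -> linear g -> (forall v w, f (v *t w) = g (v *t w)) -> f =1 g.
Proof.
move=> fl gl fg t.
elim/tensor_ind: t => [|//|a t t' IH IH']; first by rewrite !linear_at0.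
by rewrite fl gl IH IH'.
Qed.

End TensorTheory.

(* A non-negatively graded F_2-vector space M = \bigoplus_n M_n with linear
   operations Sq^i raising degrees by i.  M is the total space and
   gr n : M -> M is the projection onto the homogeneous component M_n. *)
HB.mixin Record isSqModule M of GRing.Lmodule 'F_2 M := {
  gr : nat -> M -> M;
  gr_is_linear : forall n, linear (gr n);
  gr_gr : forall m n x, gr m (gr n x) = if m == n then gr n x else 0;
  gr_fin : forall x, exists N : nat, x = \sum_(n < N) gr n x;
  Sq : nat -> M -> M;
  Sq_is_linear : forall i, linear (Sq i);
  Sq_gr : forall i n x, gr (n + i) (Sq i (gr n x)) = Sq i (gr n x)
}.

#[short(type="sqModType")]
HB.structure Definition SqModule := {M of isSqModule M & GRing.Lmodule 'F_2 M}.

(* A module over the Steenrod algebra is a graded module over its generators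
   Sq^i on which the defining relations Sq^0 = 1 and Adem hold. *)
HB.mixin Record isUnstable M of SqModule M := {
  Sq0 : forall x : M, Sq 0 x = x;
  Adem : forall (a b : nat) (x : M), (0 < a)%N -> (a < 2 * b)%N ->
    Sq a (Sq b x) =
    \sum_(c < (a %/ 2).+1) Sq (a + b - c) (Sq c x) *+ 'C(b - c - 1, a - 2 * c);
  Sq_unstable : forall (i n : nat) (x : M), (n < i)%N -> gr n x = x ->
    Sq i x = 0
}.

#[short(type="unstableModType")]
HB.structure Definition UnstableModule := {M of isUnstable M & SqModule M}.

HB.instance Definition _ (M : sqModType) n :=
  GRing.isLinear.Build 'F_2 M M *:%R (@gr M n) (gr_is_linear n).
HB.instance Definition _ (M : sqModType) i :=
  GRing.isLinear.Build 'F_2 M M *:%R (@Sq M i) (Sq_is_linear i).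

Definition homogeneous (M : sqModType) (n : nat) (x : M) : Prop := gr n x = x.

Section SqModuleTheory.
Context (M : sqModType).
Implicit Types x : M.

Lemma gr_hom m n x : homogeneous n x -> gr m x = if m == n then x else 0.
Proof. by rewrite /homogeneous => xn; rewrite -xn gr_gr. Qed.

Lemma homogeneous_gr n x : homogeneous n (gr n x).
Proof. by rewrite /homogeneous gr_gr eqxx. Qed.

Lemma homogeneous_Sq i n x : homogeneous n x -> homogeneous (n + i) (Sq i x).
Proof. by rewrite /homogeneous => xn; rewrite -xn Sq_gr. Qed.

Lemma gr_fin_eq x : exists N : nat, x == \sum_(n < N) gr n x.
Proof. by have [N xN] := gr_fin x; exists N; apply/eqP. Qed.

Definition gr_bound x : nat := ex_minn (gr_fin_eq x).

Lemma gr_boundE x : x = \sum_(n < gr_bound x) gr n x.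
Proof. by rewrite /gr_bound; case: ex_minnP => N /eqP. Qed.

Lemma gr_geq_bound n x : (gr_bound x <= n)%N -> gr n x = 0.
Proof.
move=> le_n; rewrite [x in gr n x]gr_boundE linear_sum big1 // => i _ /=.
by rewrite gr_gr gtn_eqF // (leq_trans (ltn_ord i)).
Qed.

End SqModuleTheory.

Section PolySq.
Context (s : nat).
Implicit Types p : {mpoly 'F_2[s]}.

Local Notation hom := (pihomog (@mdeg s)).

(* The total square \sum_k Sq^k on F_2[x_1, ..., x_s]: the ring morphism
   x_i |-> x_i + x_i^2. *)
Definition total_Sq p := p \mPo [tuple 'X_i + 'X_i ^+ 2 | i < s].

Definition mpoly_Sq (k : nat) p :=
  \sum_(n < msize p) hom (n + k)%N (total_Sq (hom n p)).

Lemma hom_geq_msize n p : (msize p <= n)%N -> hom n p = 0.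
Proof.
move=> le_n; rewrite pihomogE big_seq_cond big1 // => m /andP[mp /eqP mn].
by have := msize_mdeg_lt mp; rewrite mn ltnNge le_n.
Qed.

Lemma hom_hom m n p : hom m (hom n p) = if m == n then hom n p else 0.
Proof.
case: eqP => [->|/eqP ne]; first exact: pihomog_id.
by apply: pihomog_ne0 (pihomogP _ n p); rewrite eq_sym.
Qed.

Lemma hom_fin p : exists N : nat, p = \sum_(n < N) hom n p.
Proof. by exists (msize p); apply: pihomog_partitionE. Qed.

Lemma total_Sq_is_linear : linear total_Sq.
Proof. by move=> a p q; rewrite /total_Sq linearP. Qed.

HB.instance Definition _ := GRing.isLinear.Build 'F_2 {mpoly 'F_2[s]}
  {mpoly 'F_2[s]} *:%R total_Sq total_Sq_is_linear.

Lemma mpoly_SqE N k p : (msize p <= N)%N ->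
  mpoly_Sq k p = \sum_(n < N) hom (n + k)%N (total_Sq (hom n p)).
Proof.
move=> le_N; rewrite (bigID (fun n : 'I_N => n < msize p)%N) /=.
rewrite [X in _ + X]big1 ?addr0 => [|i]; last first.
  by rewrite -leqNgt => /hom_geq_msize ->; rewrite !linear0.
exact: (big_ord_widen N (fun n => hom (n + k)%N (total_Sq (hom n p)))).
Qed.

Lemma mpoly_Sq_is_linear k : linear (mpoly_Sq k).
Proof.
move=> a p q; set N := maxn (msize (a *: p + q)) (maxn (msize p) (msize q)).
rewrite !(@mpoly_SqE N) /N ?leq_max ?leqnn ?orbT //.
rewrite scaler_sumr -big_split; apply: eq_bigr => i _ /=.
by rewrite !linearP.
Qed.

Lemma mpoly_Sq_hom k n p : hom (n + k)%N (mpoly_Sq k (hom n p)) =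
  mpoly_Sq k (hom n p).
Proof.
rewrite /mpoly_Sq linear_sum; apply: eq_bigr => i _ /=.
rewrite hom_hom eqn_add2r eq_sym hom_hom.
by case: eqP => // _; rewrite !linear0.
Qed.

HB.instance Definition _ := isSqModule.Build {mpoly 'F_2[s]}
  (fun n => @pihomog_is_linear s 'F_2 _ n) hom_hom hom_fin
  mpoly_Sq_is_linear mpoly_Sq_hom.

End PolySq.

Section TensorSq.
Context (V W : sqModType).

Definition tensor_gr (n : nat) : V ⊗ W -> V ⊗ W :=
  tlift (fun v w => \sum_(i < n.+1) gr i v *t gr (n - i) w).

(* The diagonal action, by the Cartan formula. *)
Definition tensor_Sq (k : nat) : V ⊗ W -> V ⊗ W :=
  tlift (fun v w => \sum_(i < k.+1) Sq i v *t Sq (k - i) w).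

Lemma bilinear_sum (n : nat) (f : 'I_n -> {linear V -> V})
    (g : 'I_n -> {linear W -> W}) :
  is_bilinear (fun v w => \sum_(i < n) f i v *t g i w).
Proof.
have [tl tr] := @tpure_bilinear _ V W.
split=> [w a v v'|v a w w']; rewrite scaler_sumr -big_split;
  apply: eq_bigr => i _ /=; rewrite linearP; first exact: tl.
exact: tr.
Qed.

Lemma tensor_grE n v w :
  tensor_gr n (v *t w) = \sum_(i < n.+1) gr i v *t gr (n - i) w.
Proof. by rewrite /tensor_gr tliftE //; apply: bilinear_sum. Qed.

Lemma tensor_SqE k v w :
  tensor_Sq k (v *t w) = \sum_(i < k.+1) Sq i v *t Sq (k - i) w.
Proof. by rewrite /tensor_Sq tliftE //; apply: bilinear_sum. Qed.

Lemma tensor_gr_is_linear n : linear (tensor_gr n).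
Proof. by apply: tlift_linear; apply: bilinear_sum. Qed.

Lemma tensor_Sq_is_linear k : linear (tensor_Sq k).
Proof. by apply: tlift_linear; apply: bilinear_sum. Qed.

HB.instance Definition _ n := GRing.isLinear.Build 'F_2 (V ⊗ W) (V ⊗ W)
  *:%R (tensor_gr n) (tensor_gr_is_linear n).
HB.instance Definition _ k := GRing.isLinear.Build 'F_2 (V ⊗ W) (V ⊗ W)
  *:%R (tensor_Sq k) (tensor_Sq_is_linear k).

Lemma tpure0l (w : W) : (0 : V) *t w = 0.
Proof.
by have [tl _] := @tpure_bilinear _ V W; exact: linear_at0 (tl w).
Qed.

Lemma tpure0r (v : V) : v *t (0 : W) = 0.
Proof.
by have [_ tr] := @tpure_bilinear _ V W; exact: linear_at0 (tr v).
Qed.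

Lemma tensor_gr_hom n i j v w : homogeneous i v -> homogeneous j w ->
  tensor_gr n (v *t w) = if n == (i + j)%N then v *t w else 0.
Proof.
move=> vi wj; rewrite tensor_grE; case: eqP => [->|/eqP ne].
  have lti : (i < (i + j).+1)%N by rewrite ltnS leq_addr.
  rewrite (bigD1 (Ordinal lti)) //= addKn vi wj big1 ?addr0 // => k.
  rewrite -val_eqE /= => nk; rewrite (gr_hom k vi) (negbTE nk).
  exact: tpure0l.
apply: big1 => k _; rewrite (gr_hom k vi) (gr_hom (n - k) wj).
case: eqP => [ki|_]; last exact: tpure0l.
case: eqP => [nk|_]; last exact: tpure0r.
by case/eqP: ne; rewrite -nk -ki subnKC // -ltnS.
Qed.

Lemma tensor_hom_ind (P : V ⊗ W -> Prop) :
  P 0 ->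
  (forall i j v w, homogeneous i v -> homogeneous j w -> P (v *t w)) ->
  (forall a t t', P t -> P t' -> P (a *: t + t')) -> forall t, P t.
Proof.
move=> P0 Pp PD; have [tl tr] := @tpure_bilinear _ V W.
have Padd x y : P x -> P y -> P (x + y).
  by move=> Px Py; rewrite -[x]scale1r; exact: PD.
have lin0 (U T : lmodType 'F_2) (f : U -> T) : linear f ->
    forall (n : nat) (F : 'I_n -> U), f (\sum_i F i) = \sum_i f (F i).
  move=> fl n F; pose g : {linear U -> T} :=
    HB.pack f (GRing.isLinear.Build 'F_2 U T *:%R f fl).
  exact: (linear_sum g).
elim/tensor_ind=> // v w; rewrite (gr_boundE v) (gr_boundE w).
rewrite (lin0 _ _ _ (tl _)); apply: (@big_ind _ P) => // i _.
rewrite (lin0 _ _ _ (tr _)); apply: (@big_ind _ P) => // j _.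
by apply: (Pp i j); apply: homogeneous_gr.
Qed.

Lemma tensor_gr_gr m n t :
  tensor_gr m (tensor_gr n t) = if m == n then tensor_gr n t else 0.
Proof.
elim/tensor_hom_ind: t => [|i j v w vi wj|a t t' IH IH'].
- by rewrite !linear0 if_same.
- rewrite (tensor_gr_hom n vi wj); case: (n =P (i + j)%N) => [->|_].
    by rewrite (tensor_gr_hom m vi wj).
  by rewrite linear0 if_same.
- by rewrite !tensor_gr_is_linear IH IH'; case: eqP => // _;
    rewrite scaler0 addr0.
Qed.

Lemma tensor_gr_fin t : exists N : nat, t = \sum_(n < N) tensor_gr n t.
Proof.
suff [N tN] : exists N, forall K, (N <= K)%N ->
    t = \sum_(n < K) tensor_gr n t by exists N; apply: tN.
elim/tensor_hom_ind: t => [|i j v w vi wj|a t t' [N IH] [N' IH']].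
- by exists 0%N => K _; rewrite big1 // => i _; rewrite linear0.
- exists (i + j).+1 => K ltK; rewrite (bigD1 (Ordinal ltK)) //=.
  rewrite (tensor_gr_hom _ vi wj) eqxx big1 ?addr0 // => k.
  by rewrite -val_eqE /= => nk; rewrite (tensor_gr_hom _ vi wj) (negbTE nk).
- exists (maxn N N') => K; rewrite geq_max => /andP[leN leN'].
  rewrite {1}(IH K leN) {1}(IH' K leN') scaler_sumr -big_split.
  by apply: eq_bigr => i _ /=; rewrite tensor_gr_is_linear.
Qed.

Lemma tensor_Sq_gr k n t :
  tensor_gr (n + k) (tensor_Sq k (tensor_gr n t)) = tensor_Sq k (tensor_gr n t).
Proof.
elim/tensor_hom_ind: t => [|i j v w vi wj|a t t' IH IH'].
- by rewrite !linear0.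
- rewrite (tensor_gr_hom n vi wj).
  case: eqP => [->|_]; last by rewrite !linear0.
  rewrite tensor_SqE linear_sum; apply: eq_bigr => a _ /=.
  rewrite (tensor_gr_hom _ (homogeneous_Sq a vi) (homogeneous_Sq (k - a) wj)).
  by rewrite addnACA subnKC ?eqxx // -ltnS.
- by rewrite !(tensor_gr_is_linear, tensor_Sq_is_linear) IH IH'.
Qed.

HB.instance Definition _ := isSqModule.Build (V ⊗ W)
  tensor_gr_is_linear tensor_gr_gr tensor_gr_fin
  tensor_Sq_is_linear tensor_Sq_gr.

End TensorSq.

Notation Pol s := {mpoly 'F_2[s]} (only parsing).

(* St1 x = \sum_n \sum_(i <= n) u^(n - i) ⊗ Sq^i x_n where x = \sum_n x_n,
   x_n homogeneous of degree n. *)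
Definition St1 (M : sqModType) (x : M) : Pol 1 ⊗ M :=
  \sum_(n < gr_bound x) \sum_(i < n.+1)
    ('X_ord0 ^+ (n - i) : Pol 1) *t Sq i (gr n x).

Lemma St1_homogeneous (M : sqModType) (n : nat) (x : M) : homogeneous n x ->
  St1 x = \sum_(i < n.+1) ('X_ord0 ^+ (n - i) : Pol 1) *t Sq i x.
Proof.
move=> xn; rewrite /St1.
have z m : m != n -> \sum_(i < m.+1)
    ('X_ord0 ^+ (m - i) : Pol 1) *t Sq i (gr m x) = 0 :> Pol 1 ⊗ M.
  move=> mn; rewrite (gr_hom m xn) (negbTE mn) big1 // => i _.
  by rewrite linear0 tpure0r.
have [le_n|lt_n] := leqP (gr_bound x) n; last first.
  rewrite (bigD1 (Ordinal lt_n)) //= xn [X in _ + X]big1 ?addr0 // => m.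
  by rewrite -val_eqE => /z.
have x0 : x = 0 by rewrite -xn gr_geq_bound.
rewrite [RHS]big1 => [|i _]; last by rewrite x0 linear0 tpure0r.
have g0 k : gr k x = 0 by rewrite x0 linear0.
by rewrite big1 // => m _; rewrite big1 // => i _; rewrite g0 linear0 tpure0r.
Qed.

Lemma tlift2E (R : comNzRingType) (V1 V2 W : lmodType R) (A : algType R)
    (f : V1 -> A) (g : V2 -> A) : linear f -> linear g -> forall v1 v2 w,
  tlift (fun p => tlift (fun q m => (f p * g q) *t m)) (v1 *t (v2 *t w)) =
  (f v1 * g v2) *t w :> A ⊗ W.
Proof.
move=> fl gl v1 v2 w; have [tl tr] := @tpure_bilinear _ A W.
have bil p : is_bilinear (fun q (m : W) => (f p * g q) *t m).
  split=> [m a q q'|q a m m']; last exact: tr.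
  by rewrite gl mulrDr -scalerAr tl.
rewrite tliftE; first by rewrite tliftE.
split=> [t a p p'|p]; last exact: tlift_linear.
elim/tensor_ind: t => [|q m|b t t' IH IH'].
- by rewrite !(linear_at0 (tlift_linear (bil _))) scaler0 addr0.
- by rewrite !(tliftE q m (bil _)) fl mulrDl -scalerAl tl.
- rewrite !(tlift_linear (bil _)) IH IH' !scalerDr !scalerA [(a * b)%R]mulrC.
  by rewrite addrACA.
Qed.

Section Recursion.
Context (s : nat) (M : sqModType).

(* P_1 ⊗ P_s is identified with P_(s + 1) by sending the variable u of P_1 to
   the first variable and x_i to x_(i + 1). *)
Definition first_var (p : Pol 1) : Pol s.+1 := p \mPo [tuple 'X_ord0 | i < 1].
Definition last_vars (p : Pol s) : Pol s.+1 :=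
  p \mPo [tuple 'X_(fintype.lift ord0 i) | i < s].

Definition merge : Pol 1 ⊗ (Pol s ⊗ M) -> Pol s.+1 ⊗ M :=
  tlift (fun p => tlift (fun q m => (first_var p * last_vars q) *t m)).

Lemma mergeE p q m :
  merge (p *t (q *t m)) = (first_var p * last_vars q) *t m.
Proof.
by apply: tlift2E => a x y; rewrite /first_var /last_vars linearP.
Qed.

(* The D_s-module structure of P_s ⊗ M is the restriction of its P_s-module
   structure. *)
Definition poly_act (d : Pol s) : Pol s ⊗ M -> Pol s ⊗ M :=
  tlift (fun p m => (d * p) *t m).

Lemma poly_actE d p m : poly_act d (p *t m) = (d * p) *t m.
Proof.
have [tl tr] := @tpure_bilinear _ (Pol s) M.
rewrite /poly_act tliftE //.
split=> [m' a p' p''|p' a m' m'']; last by rewrite /= tr.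
by rewrite mulrDr -scalerAr tl.
Qed.

End Recursion.

Fixpoint St (s : nat) (M : sqModType) (x : M) : Pol s ⊗ M :=
  match s with
  | 0 => (1 : Pol 0) *t x
  | s'.+1 => merge (St1 (St s' x))
  end.

Definition dickson (s : nat) : {pred Pol s} := fun p =>
  [forall g : 'M['F_2]_s,
    (g \in unitmx) ==> (p \mPo [tuple \sum_j g i j *: 'X_j | i < s] == p)].

Arguments dickson : clear implicits.

Definition singer (s : nat) (M : sqModType) : {pred Pol s ⊗ M} := fun z =>
  `[< exists r : seq (Pol s * M),
        (forall y, y \in r -> y.1 \in dickson s) /\
        z = \sum_(y <- r) poly_act y.1 (St s y.2) >].

Arguments singer : clear implicits.

(* The augmentation ideal of the Steenrod algebra is spanned by the monomials
   Sq^i_1 ... Sq^i_k of positive degree. *)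
Definition decomposable (N : sqModType) (y : N) : Prop :=
  exists (I : seq nat) (x : N), (0 < sumn I)%N /\ y = foldr (@Sq N) x I.

Definition indecomposables (N : sqModType) : lmodType 'F_2 :=
  quotspan (@decomposable N).

Definition indec_proj (N : sqModType) : N -> indecomposables N :=
  quot_pi (@decomposable N).

Definition singer_to_indec (s : nat) (M : sqModType)
    (z : {z : Pol s ⊗ M | z \in singer s M}) :
    indecomposables (Pol s ⊗ M) :=
  indec_proj (sval z).

(* Main.v *)
Require Import Defs.
From HB Require Import structures.
From mathcomp Require Import all_boot all_order all_algebra.
From mathcomp Require Import boolp.
From mathcomp Require Import freeg mpoly.
From mathcomp Require Import zify ring.

Set Implicit Arguments.
Unset Strict Implicit.
Unset Printing Implicit Defensive.

Import GRing.Theory.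
Local Open Scope ring_scope.

(** Write u, v for the two outermost variables, so that
    St_s x = St_1 (St_1 (St_(s-2) x)), and |z| for the degree of z.  Call an
    element hit if it is a sum of squares Sq^k y with k > 0.

    By transvection invariance alone, a Dickson invariant f is a combination of
    terms q0^p q1^q St_2 h, where q0 = uv(u + v) and q1 = u^2 + uv + v^2 are the
    Dickson invariants of u and v, h is a polynomial in the other variables and
    St_2 h is its twofold total power ([dickson_decomposition]).  The total power
    being multiplicative, f . St_s x is a sum of elements q0^p q1^q St_2 z with
    z = h . St_(s-2) x, and the theorem rests on the following
    ([dickson2_pow_hit]): q0^p q1^q St_2 z is hit as soon as |z| > 0.

    For this, expand in monomials in u and in v^2 + uv, the total power of the
    inner variable; there remain elements u^a St_1 y with y = v^c St_1 z.  In one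
    variable, the total square of X + X^3 + X^7 + ... (the spikes) is a truncated
    geometric series, that is, up to one more term, the series that defines
    u^a St_1 y.  Hence u^a St_1 y is hit unless a + |y| + 1 is a power 2^T, and
    then it is u^(2^T - 1) y modulo hits ([total_power_spikes]).  Now apply the
    same formula to y and the inner variable: y is a sum of proper squares Sq^j,
    except possibly when c + |z| + 1 is a power of two.  A spike times a proper
    square of degree below the spike is hit ([pred_pow2_Sq_hit]), by two more
    identities between polynomials in X + X^2.  Both sums can be powers of two,
    but when |z| > 0 the binomial coefficient with which such a term occurs in
    q0^p q1^q is even ([odd_bin_dvd]).

    There remain the components of degree 0 of the elements z.  They only see f
    with all variables but u and v set to zero ([dickson_span_hit]).  Restricting
    f to u = 0 gives a square, since the translations of the other variables by u
    force all derivatives of the restriction to vanish ([restrict_square]); a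
    third variable exchanged with u makes f(u, v, 0, ...) a restriction of that
    kind ([keep2_square]).  This is where s > 2 enters.  Finally g^2 times a class
    of degree 0 is, monomial by monomial, a top square, hence hit in positive
    degrees ([square_degree0]). *)

(** * Linear maps and substitutions over F_2 *)

Section LinearMaps.
Context (R : pzRingType) (U V W : lmodType R).

Lemma linD (f : U -> V) : linear f -> {morph f : x y / x + y}.
Proof. by move=> fl x y; rewrite -[x in LHS]scale1r fl scale1r. Qed.

Lemma lin_sum (f : U -> V) : linear f ->
  forall (I : Type) (r : seq I) (Q : pred I) (F : I -> U),
  f (\sum_(i <- r | Q i) F i) = \sum_(i <- r | Q i) f (F i).
Proof. by move=> fl I r Q F; apply: (big_morph f (linD fl) (linear_at0 fl)). Qed.

Lemma linMn (f : U -> V) : linear f -> forall n, {morph f : x / x *+ n}.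
Proof.
move=> fl; elim=> [|n IH] x; first by rewrite !mulr0n (linear_at0 fl).
by rewrite !mulrS (linD fl) IH.
Qed.

Lemma linB (f : U -> V) : linear f -> {morph f : x y / x - y}.
Proof. by move=> fl x y; rewrite -scaleN1r addrC fl scaleN1r addrC. Qed.

Lemma lin_comp (f : V -> W) (g : U -> V) :
  linear f -> linear g -> linear (fun x => f (g x)).
Proof. by move=> fl gl a x y; rewrite gl fl. Qed.

Lemma lin_add (f g : U -> V) :
  linear f -> linear g -> linear (fun x => f x + g x).
Proof. by move=> fl gl a x y; rewrite fl gl scalerDr addrACA. Qed.

End LinearMaps.

Lemma addxx2 (V : lmodType 'F_2) (x : V) : x + x = 0.
Proof.
rewrite -[x]scale1r -scalerDl.
have -> : 1 + 1 = 0 :> 'F_2 by exact/val_inj.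
by rewrite scale0r.
Qed.

Lemma mulrn_odd (V : lmodType 'F_2) (x : V) n : x *+ n = if odd n then x else 0.
Proof.
rewrite -{1}(odd_double_half n) -mul2n mulrnDr mulrnA mulr2n addxx2 mul0rn addr0.
by case: odd.
Qed.

Lemma pow2_gt0 n : (0 < 2 ^ n)%N.
Proof. by rewrite expn_gt0. Qed.

Lemma lt_up_log2 r n : (r < up_log 2 n)%N -> (2 ^ r < n)%N.
Proof.
by rewrite ltnNge; apply: contraNltn => le_n; apply: up_log_min.
Qed.

Lemma monomial_ind (s : nat) (P : 'X_{1..s} -> Prop) :
  P 0%MM -> (forall m i, P m -> P (U_(i) + m)%MM) -> forall m, P m.
Proof.
move=> P0 PU m; elim: {m}(mdeg m) {-2}m (erefl (mdeg m)) => [|d IH] m dm.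
  by move/eqP: dm; rewrite mdeg_eq0 => /eqP ->.
have [i mi] : exists i, (0 < m i)%N.
  apply/existsP; apply: contraT; rewrite negb_exists => /forallP m0.
  suff m00 : m = 0%MM by rewrite m00 mdeg0 in dm.
  by apply/mnmP => i; rewrite mnm0E; apply/eqP; rewrite -leqn0 leqNgt m0.
have E : m = (U_(i) + (m - U_(i)))%MM by rewrite addmC submK // lep1mP -lt0n.
rewrite E; apply: PU; apply: IH.
by move: dm; rewrite {1}E mdegD mdeg1 add1n => -[].
Qed.

Lemma mpoly_lin_ind (s : nat) (P : {mpoly 'F_2[s]} -> Prop) :
  (forall a p q, P p -> P q -> P (a *: p + q)) ->
  P 1 -> (forall i m, P 'X_[m] -> P ('X_i * 'X_[m])) -> forall p, P p.
Proof.
move=> PD P1 PX p; rewrite [p]mpolyE; elim: (msupp p) => [|m r IH].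
  by rewrite big_nil; have := PD (-1) _ _ P1 P1; rewrite scaleN1r addNr.
rewrite big_cons; apply: PD => //.
elim/monomial_ind: m => [|m i IHm]; first by rewrite mpolyX0.
by rewrite mpolyXD; apply: PX.
Qed.

Definition subst s t (h : 'I_s -> {mpoly 'F_2[t]}) (p : {mpoly 'F_2[s]}) :=
  p \mPo [tuple h i | i < s].

Lemma substX s t (h : 'I_s -> {mpoly 'F_2[t]}) i : subst h 'X_i = h i.
Proof. by rewrite /subst comp_mpolyXU -tnth_nth tnth_mktuple. Qed.

Lemma subst_linear s t (h : 'I_s -> {mpoly 'F_2[t]}) : linear (subst h).
Proof. by move=> a p q; rewrite /subst linearP. Qed.

Lemma substM s t (h : 'I_s -> {mpoly 'F_2[t]}) : {morph subst h : p q / p * q}.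
Proof. by move=> p q; rewrite /subst rmorphM. Qed.

Lemma subst1 s t (h : 'I_s -> {mpoly 'F_2[t]}) : subst h 1 = 1.
Proof. by rewrite /subst rmorph1. Qed.

Lemma substXn s t (h : 'I_s -> {mpoly 'F_2[t]}) p n :
  subst h (p ^+ n) = subst h p ^+ n.
Proof. by elim: n => [|n IH]; rewrite ?subst1 // !exprS substM IH. Qed.

Lemma substD s t (h : 'I_s -> {mpoly 'F_2[t]}) : {morph subst h : p q / p + q}.
Proof. exact: linD (subst_linear h). Qed.

Lemma subst0 s t (h : 'I_s -> {mpoly 'F_2[t]}) : subst h 0 = 0.
Proof. exact: linear_at0 (subst_linear h). Qed.

Lemma subst_ext s t (f g : {mpoly 'F_2[s]} -> {mpoly 'F_2[t]}) :
  linear f -> linear g -> {morph f : p q / p * q} -> {morph g : p q / p * q} ->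
  f 1 = g 1 -> (forall i, f 'X_i = g 'X_i) -> f =1 g.
Proof.
move=> fl gl fM gM fg1 fgX; elim/mpoly_lin_ind => [a p q IH IH'||i m IH] //.
  by rewrite fl gl IH IH'.
by rewrite fM gM fgX IH.
Qed.

Lemma subst_comp s t u (h : 'I_s -> {mpoly 'F_2[t]}) (k : 'I_t -> {mpoly 'F_2[u]}) p :
  subst k (subst h p) = subst (fun i => subst k (h i)) p.
Proof.
move: p; apply: subst_ext.
- by move=> a p q; rewrite !subst_linear.
- exact: subst_linear.
- by move=> p q; rewrite !substM.
- exact: substM.
- by rewrite !subst1.
- by move=> i; rewrite !substX.
Qed.

Lemma eq_subst s t (h h' : 'I_s -> {mpoly 'F_2[t]}) : h =1 h' -> subst h =1 subst h'.
Proof. by move=> hh' p; congr (p \mPo _); apply: eq_mktuple. Qed.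

Lemma sqrD_mpoly s (p q : {mpoly 'F_2[s]}) : (p + q) ^+ 2 = p ^+ 2 + q ^+ 2.
Proof. by rewrite sqrrD mulr2n addxx2 addr0. Qed.

Lemma F2_sqr (a : 'F_2) : a ^+ 2 = a.
Proof. by case: a => -[|[|m]] lt_m //; apply/val_inj. Qed.

Lemma sqr_subst s (p : {mpoly 'F_2[s]}) : p ^+ 2 = subst (fun i => 'X_i ^+ 2) p.
Proof.
elim/mpoly_lin_ind: p => [a p q IH IH'||i m IH].
- by rewrite sqrD_mpoly exprZn F2_sqr IH IH' subst_linear.
- by rewrite subst1 expr1n.
- by rewrite exprMn IH substM substX.
Qed.

(** * Steenrod squares of a variable times a polynomial *)

Lemma homMX (s : nat) (i : 'I_s) (n : nat) (p : {mpoly 'F_2[s]}) :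
  pihomog mdeg n.+1 ('X_i * p) = 'X_i * pihomog mdeg n p.
Proof.
elim/mpoly_lin_ind: p => [a p q IH IH'||j m _].
- by rewrite mulrDr -scalerAr !linearP /= IH IH' mulrDr scalerAr.
- rewrite mulr1 -mpolyX0 !pihomogX /= mdeg0 mdeg1 eqSS; case: eqP; rewrite ?mulr0 //.
  by rewrite mpolyX0 mulr1.
- rewrite -!mpolyXD !pihomogX /= !mdegD !mdeg1 !add1n eqSS.
  by case: ifP; rewrite ?mulr0 // mpolyXD.
Qed.

Lemma homMX0 (s : nat) (i : 'I_s) (p : {mpoly 'F_2[s]}) :
  pihomog mdeg 0 ('X_i * p) = 0.
Proof.
elim/mpoly_lin_ind: p => [a p q IH IH'||j m _].
- by rewrite mulrDr -scalerAr !linearP /= IH IH' scaler0 addr0.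
- by rewrite mulr1 pihomogX /= mdeg1.
- by rewrite -!mpolyXD !pihomogX /= !mdegD !mdeg1.
Qed.

Lemma mpoly_SqX (s : nat) (k : nat) (m : 'X_{1..s}) :
  Sq k ('X_[m] : {mpoly 'F_2[s]}) =
  pihomog mdeg (mdeg m + k)%N (total_Sq 'X_[m]).
Proof.
transitivity (mpoly_Sq k 'X_[m]); first by [].
rewrite (@mpoly_SqE _ (mdeg m).+1) ?msizeX //.
rewrite big_ord_recr /= big1 ?add0r => [|i _]; rewrite pihomogX /= ?eqxx //.
by rewrite gtn_eqF ?(ltn_ord i) // !linear0.
Qed.

Lemma total_SqMX (s : nat) (i : 'I_s) p :
  total_Sq ('X_i * p) = ('X_i + 'X_i ^+ 2) * total_Sq p.
Proof.
by rewrite /total_Sq rmorphM /= comp_mpolyXU -tnth_nth tnth_mktuple.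
Qed.

Lemma mpoly_SqMX (s : nat) (i : 'I_s) k (p : {mpoly 'F_2[s]}) :
  Sq k.+1 ('X_i * p) = 'X_i * Sq k.+1 p + 'X_i ^+ 2 * Sq k p.
Proof.
elim/mpoly_lin_ind: p => [a p q IH IH'||j m _].
- rewrite mulrDr -scalerAr !linearP /= IH IH' !mulrDr !scalerDr !scalerAr.
  by rewrite addrACA.
- rewrite -mpolyX0 -mpolyXD !mpoly_SqX mpolyXD total_SqMX mdegD mdeg0 addn0.
  rewrite mdeg1 add1n mulrDl linearD /= homMX expr2 -mulrA addnS !homMX.
  by rewrite mulrA.
- rewrite -!mpolyXD !mpoly_SqX mpolyXD total_SqMX mdegD mdeg1 add1n mulrDl.
  by rewrite linearD /= homMX expr2 -mulrA addnS addSn !homMX mulrA.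
Qed.

Lemma hom_total_Sq_low (s n : nat) (m : 'X_{1..s}) :
  (n < mdeg m)%N -> pihomog mdeg n (total_Sq 'X_[m]) = 0.
Proof.
elim/monomial_ind: m n => [n|m i IH n].
  by rewrite mdeg0.
rewrite mdegD mdeg1 add1n mpolyXD total_SqMX mulrDl linearD /= expr2 -mulrA.
case: n => [|n]; first by rewrite !homMX0 addr0.
rewrite ltnS !homMX => /[dup] /IH -> lt_n; rewrite mulr0 add0r.
case: n lt_n => [|n] lt_n; first by rewrite homMX0 mulr0.
by rewrite homMX IH ?mulr0 // ltnW.
Qed.

Lemma mpoly_SqMX0 (s : nat) (i : 'I_s) (p : {mpoly 'F_2[s]}) :
  Sq 0 ('X_i * p) = 'X_i * Sq 0 p.
Proof.
have X m : Sq 0 ('X_i * 'X_[m]) = 'X_i * Sq 0 'X_[m] :> {mpoly 'F_2[s]}.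
  rewrite -mpolyXD !mpoly_SqX mpolyXD total_SqMX mdegD mdeg1 !addn0 add1n.
  rewrite mulrDl linearD /= homMX expr2 -mulrA homMX.
  have -> : pihomog mdeg (mdeg m) ('X_i * total_Sq 'X_[m]) = 0.
    case E: (mdeg m) => [|e]; first by rewrite homMX0.
    by rewrite homMX hom_total_Sq_low ?E ?mulr0.
  by rewrite mulr0 addr0.
elim/mpoly_lin_ind: p => [a p q IH IH'||j m _].
- by rewrite mulrDr -scalerAr !linearP /= IH IH' mulrDr scalerAr.
- by rewrite -mpolyX0.
- by rewrite -mpolyXD.
Qed.

Lemma mpoly_Sq1 (s : nat) k : Sq k (1 : {mpoly 'F_2[s]}) = if k == 0%N then 1 else 0.
Proof.
rewrite -mpolyX0 mpoly_SqX mdeg0 add0n mpolyX0 /total_Sq rmorph1 -mpolyX0.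
by rewrite pihomogX /= mdeg0 eq_sym mpolyX0.
Qed.

(** * The modules Pol s ⊗ M *)

(** The modules Pol s ⊗ M for all s, with the structure maps of the quotient
    construction hidden.  Every identity below is checked on pure tensors and
    extended by linearity, so these rules are all that is needed; stating them
    for an abstract family keeps the quotient of the free module out of
    unification.  The variable added by [shift] is the variable 0. *)
Record tensor_tower (M : sqModType) := TensorTower {
  level : nat -> sqModType;
  pure : forall s, {mpoly 'F_2[s]} -> M -> level s;
  act : forall s, {mpoly 'F_2[s]} -> level s -> level s;
  shift : forall s, level s -> level s.+1;
  level_ind : forall s (Q : level s -> Prop),
    (forall a t t', Q t -> Q t' -> Q (a *: t + t')) ->
    (forall p x, Q (pure p x)) -> forall t, Q t;
  pure_linearl : forall s (x : M), linear (fun p : {mpoly 'F_2[s]} => pure p x);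
  pure_linearr : forall s (p : {mpoly 'F_2[s]}), linear (pure p);
  gr_pure : forall s n (p : {mpoly 'F_2[s]}) x,
    gr n (pure p x) = \sum_(i < n.+1) pure (gr i p) (gr (n - i) x);
  Sq_pure : forall s k (p : {mpoly 'F_2[s]}) x,
    Sq k (pure p x) = \sum_(i < k.+1) pure (Sq i p) (Sq (k - i) x);
  act_linear : forall s (p : {mpoly 'F_2[s]}), linear (@act s p);
  act_pure : forall s (p q : {mpoly 'F_2[s]}) x,
    act p (pure q x) = pure (p * q) x;
  shift_linear : forall s, linear (@shift s);
  shift_pure : forall s (p : {mpoly 'F_2[s]}) x,
    shift (pure p x) = pure (last_vars p) x
}.

Local Notation "p • t" := (act p t) (at level 40, left associativity).

Section Action.
Context (M : sqModType) (N : tensor_tower M) (s : nat).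
Local Notation P := {mpoly 'F_2[s]}.
Implicit Types (p q : P) (t : level N s).

Lemma act1 t : 1 • t = t.
Proof.
elim/level_ind: t => [a t t' IH IH'|p x]; first by rewrite act_linear IH IH'.
by rewrite act_pure mul1r.
Qed.

Lemma actM p q t : (p * q) • t = p • (q • t).
Proof.
elim/level_ind: t => [a t t' IH IH'|r x]; first by rewrite !act_linear IH IH'.
by rewrite !act_pure mulrA.
Qed.

Lemma act_linearl t : linear (fun p : P => p • t).
Proof.
move=> a p q; elim/level_ind: t => [b t t' IH IH'|r x].
  by rewrite !act_linear IH IH' !scalerDr addrACA !scalerA mulrC.
by rewrite !act_pure mulrDl -scalerAl pure_linearl.
Qed.

Lemma Sq_varS i k t :
  Sq k.+1 ('X_i • t) = 'X_i • Sq k.+1 t + 'X_i ^+ 2 • Sq k t.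
Proof.
elim/level_ind: t => [a t t' IH IH'|p x].
  rewrite act_linear !(Sq_is_linear _ a) !act_linear IH IH'.
  by rewrite scalerDr addrACA.
rewrite act_pure !Sq_pure !(lin_sum (act_linear _)).
rewrite [in LHS]big_ord_recl [X in _ = X + _]big_ord_recl mpoly_SqMX0.
rewrite act_pure -addrA; congr (_ + _); rewrite -big_split.
apply: eq_bigr => j _; rewrite /= !act_pure /bump /= !add1n subSS mpoly_SqMX.
by rewrite (linD (pure_linearl _ _)).
Qed.

Lemma Sq_var0 i t : Sq 0 ('X_i • t) = 'X_i • Sq 0 t.
Proof.
elim/level_ind: t => [a t t' IH IH'|p x].
  by rewrite act_linear !(Sq_is_linear _ a) !act_linear IH IH'.
by rewrite act_pure !Sq_pure !big_ord1 mpoly_SqMX0 act_pure.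
Qed.

Lemma gr_varS i n t : gr n.+1 ('X_i • t) = 'X_i • gr n t.
Proof.
elim/level_ind: t => [a t t' IH IH'|p x].
  by rewrite act_linear !(gr_is_linear _ a) !act_linear IH IH'.
rewrite act_pure !gr_pure big_ord_recl [gr (ord0 : 'I_ _) _]homMX0.
rewrite (linear_at0 (pure_linearl _ _)) add0r (lin_sum (act_linear _)).
apply: eq_bigr => j _.
rewrite /= /bump /= add1n subSS [gr j.+1 _]homMX.
by rewrite act_pure.
Qed.

Lemma gr_var0 i t : gr 0 ('X_i • t) = 0.
Proof.
elim/level_ind: t => [a t t' IH IH'|p x].
  by rewrite act_linear (gr_is_linear _ a) IH IH' scaler0 addr0.
by rewrite act_pure gr_pure big_ord1 [gr _ _]homMX0 (linear_at0 (pure_linearl _ _)).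
Qed.

Lemma Sq_pure1 k (x : M) : Sq k (pure N (1 : P) x) = pure N 1 (Sq k x).
Proof.
rewrite Sq_pure big_ord_recl big1 ?addr0 => [|i _]; rewrite mpoly_Sq1 /=.
  by rewrite subn0.
by rewrite (linear_at0 (pure_linearl _ _)).
Qed.

Lemma gr_pure1 n (x : M) : gr n (pure N (1 : P) x) = pure N 1 (gr n x).
Proof.
rewrite gr_pure big_ord_recl -mpolyX0 big1 ?addr0 => [|i _].
  by rewrite [gr _ 'X_[_]]pihomogX /= mdeg0 subn0.
by rewrite [gr _ 'X_[_]]pihomogX /= mdeg0 (linear_at0 (pure_linearl _ _)).
Qed.

(** The Cartan formula has only two terms for multiplication by a variable, so
    that identities between squares are best checked one variable at a time. *)
Lemma module_ind (Q : level N s -> Prop) :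
  (forall a t t', Q t -> Q t' -> Q (a *: t + t')) ->
  (forall x, Q (pure N 1 x)) ->
  (forall i t, Q t -> Q ('X_i • t)) -> forall t, Q t.
Proof.
move=> QD Q1 QX; apply: level_ind => // p x.
elim/mpoly_lin_ind: p => [a p q IH IH'|//|i m IH].
  by rewrite pure_linearl; apply: QD.
by rewrite -act_pure; apply: QX.
Qed.

Lemma shift_act p t : shift (p • t) = last_vars p • shift t.
Proof.
elim/level_ind: t => [a t t' IH IH'|q x].
  by rewrite act_linear !shift_linear act_linear IH IH'.
by rewrite act_pure !shift_pure act_pure [last_vars _]rmorphM.
Qed.

Lemma last_varsX i : last_vars ('X_i : P) = 'X_(fintype.lift ord0 i).
Proof. by rewrite /last_vars comp_mpolyXU -tnth_nth tnth_mktuple. Qed.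

Lemma shift_var i t : shift ('X_i • t) = 'X_(fintype.lift ord0 i) • shift t.
Proof. by rewrite shift_act last_varsX. Qed.

Lemma shift_pure1 (x : M) : shift (pure N (1 : P) x) = pure N 1 x.
Proof. by rewrite shift_pure [last_vars _]rmorph1. Qed.

Lemma homogeneous_var i n t : homogeneous n t -> homogeneous n.+1 ('X_i • t).
Proof. by rewrite /homogeneous => tn; rewrite gr_varS tn. Qed.

Lemma homogeneous_varX i a n t : homogeneous n t ->
  homogeneous (a + n) ('X_i ^+ a • t).
Proof.
move=> tn; elim: a => [|a IH]; first by rewrite expr0 act1.
by rewrite exprS actM addSn; apply: homogeneous_var.
Qed.

End Action.

Section ActionShift.
Context (M : sqModType) (N : tensor_tower M) (s : nat).
Local Notation P := {mpoly 'F_2[s]}.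
Implicit Types (p q : P) (t : level N s).

Lemma shift_Sq k t : shift (Sq k t) = Sq k (shift t).
Proof.
elim/module_ind: t k => [a t t' IH IH'|x|i t IH] k.
- by rewrite Sq_is_linear !shift_linear Sq_is_linear IH IH'.
- by rewrite shift_pure1 !Sq_pure1 shift_pure1.
- case: k => [|k]; first by rewrite Sq_var0 !shift_var Sq_var0 IH.
  rewrite Sq_varS (linD (@shift_linear _ _ _)) shift_var !expr2 !actM.
  by rewrite !shift_var Sq_varS !IH expr2 actM.
Qed.

Lemma shift_gr n t : shift (gr n t) = gr n (shift t).
Proof.
elim/module_ind: t n => [a t t' IH IH'|x|i t IH] n.
- by rewrite gr_is_linear !shift_linear gr_is_linear IH IH'.
- by rewrite shift_pure1 !gr_pure1 shift_pure1.
- case: n => [|n].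
    by rewrite gr_var0 !shift_var gr_var0 (linear_at0 (@shift_linear _ _ _)).
  by rewrite gr_varS !shift_var gr_varS IH.
Qed.

Lemma homogeneous_shift n t : homogeneous n t -> homogeneous n (shift t).
Proof. by rewrite /homogeneous -shift_gr => ->. Qed.

End ActionShift.

Section UnstableAction.
Context (M : unstableModType) (N : tensor_tower M) (s : nat).
Local Notation P := {mpoly 'F_2[s]}.
Implicit Types (p q : P) (t : level N s).

Lemma Sq0_id t : Sq 0 t = t.
Proof.
elim/module_ind: t => [a t t' IH IH'|x|i t IH].
- by rewrite Sq_is_linear IH IH'.
- by rewrite Sq_pure1 Sq0.
- by rewrite Sq_var0 IH.
Qed.

Lemma Sq_gr_eq0 k n t : (n < k)%N -> Sq k (gr n t) = 0.
Proof.
elim/module_ind: t k n => [a t t' IH IH'|x|i t IH] k n lt_nk.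
- by rewrite gr_is_linear Sq_is_linear IH // IH' // scaler0 addr0.
- rewrite gr_pure1 Sq_pure1 (@Sq_unstable M k n) // ?gr_gr ?eqxx //.
  by rewrite (linear_at0 (pure_linearr _ _)).
- case: n lt_nk => [|n] lt_nk.
    by rewrite gr_var0 (linear_at0 (Sq_is_linear k)).
  case: k lt_nk => [|k] lt_nk; first by [].
  rewrite gr_varS Sq_varS (IH k.+1 n (ltnW lt_nk)) (IH k n lt_nk).
  by rewrite !(linear_at0 (act_linear _)) addr0.
Qed.

Lemma Sq_hom_eq0 k n t : homogeneous n t -> (n < k)%N -> Sq k t = 0.
Proof. by move=> <- /Sq_gr_eq0. Qed.

Lemma Sq_varX i a k t :
  Sq k ('X_i ^+ a • t) =
  \sum_(j < k.+1) ('X_i ^+ (a + j) • Sq (k - j) t) *+ 'C(a, j).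
Proof.
elim: a k => [|a IH] k.
  rewrite expr0 act1 big_ord_recl big1 ?addr0 /= ?subn0 ?bin0.
    by rewrite act1.
  by move=> j _; rewrite bin0n mulr0n.
rewrite exprS actM; case: k => [|k].
  by rewrite Sq_var0 IH !big_ord1 !bin0 !mulr1n !addn0 exprS actM.
rewrite Sq_varS !IH [in LHS]big_ord_recl /= [in RHS]big_ord_recl /= !bin0 !mulr1n.
rewrite (linD (act_linear _)) -addrA !addn0.
congr (_ + _); first by rewrite exprS actM.
rewrite !(lin_sum (act_linear _)) -big_split; apply: eq_bigr => j _ /=.
rewrite /bump /= !add1n subSS binS mulrnDr !(linMn (act_linear _)) -!actM.
by rewrite -exprS -exprD add2n addSn addnS.
Qed.

End UnstableAction.

Section TensorTower.
Context (M : sqModType).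

Lemma tensor_pure_linearl s (x : M) :
  linear (fun p : {mpoly 'F_2[s]} => p *t x).
Proof. by have [tl _] := @tpure_bilinear _ {mpoly 'F_2[s]} M; apply: tl. Qed.

Lemma tensor_pure_linearr s (p : {mpoly 'F_2[s]}) : linear (fun x : M => p *t x).
Proof. by have [_ tr] := @tpure_bilinear _ {mpoly 'F_2[s]} M; apply: tr. Qed.

Lemma poly_act_linear s (p : {mpoly 'F_2[s]}) : linear (@poly_act s M p).
Proof.
apply: tlift_linear; split=> [x a q q'|q a x y]; last exact: tensor_pure_linearr.
by rewrite mulrDr -scalerAr tensor_pure_linearl.
Qed.

Definition tensor_shift s : {mpoly 'F_2[s]} ⊗ M -> {mpoly 'F_2[s.+1]} ⊗ M :=
  tlift (fun p x => last_vars p *t x).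

Lemma shift_bilinear s :
  is_bilinear (fun (p : {mpoly 'F_2[s]}) (x : M) => last_vars p *t x).
Proof.
split=> [x a p q|p a x y]; last exact: tensor_pure_linearr.
by rewrite [last_vars _]linearP tensor_pure_linearl.
Qed.

Lemma tensor_shift_linear s : linear (@tensor_shift s).
Proof. exact: tlift_linear (@shift_bilinear s). Qed.

Lemma tensor_shiftE s (p : {mpoly 'F_2[s]}) (x : M) :
  tensor_shift (p *t x) = last_vars p *t x.
Proof. exact: tliftE (@shift_bilinear s). Qed.

Lemma tensor_level_ind s (Q : {mpoly 'F_2[s]} ⊗ M -> Prop) :
  (forall a t t', Q t -> Q t' -> Q (a *: t + t')) ->
  (forall p x, Q (p *t x)) -> forall t, Q t.
Proof.
move=> QD Qp; apply: tensor_ind => //.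
by have := QD (-1) _ _ (Qp 0 0) (Qp 0 0); rewrite scaleN1r addNr.
Qed.

Definition tensors : tensor_tower M :=
  @TensorTower M (fun s => {mpoly 'F_2[s]} ⊗ M) (fun s p x => p *t x)
    (fun s => @poly_act s M) tensor_shift tensor_level_ind
    tensor_pure_linearl tensor_pure_linearr
    (fun s n p x => tensor_grE n p x) (fun s k p x => tensor_SqE k p x)
    poly_act_linear (fun s p q x => @poly_actE s M p q x)
    tensor_shift_linear tensor_shiftE.

End TensorTower.

(** * The total power *)

Section TotalPowerDef.
Context (M : sqModType) (N : tensor_tower M) (s : nat).
Implicit Types t : level N s.

Definition total_power_gr n t : level N s.+1 :=
  \sum_(i < n.+1) 'X_ord0 ^+ (n - i) • shift (Sq i (gr n t)).

Lemma total_power_gr_linear n : linear (total_power_gr n).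
Proof.
move=> a t t'; rewrite /total_power_gr scaler_sumr -big_split /=.
apply: eq_bigr => i _.
by rewrite gr_is_linear Sq_is_linear shift_linear act_linear.
Qed.

(** The operation St_1 on Pol s ⊗ M, followed by the identification of
    Pol 1 ⊗ (Pol s ⊗ M) with Pol s.+1 ⊗ M; [merge_St1] compares the two. *)
Definition total_power t : level N s.+1 :=
  \sum_(n < gr_bound t) total_power_gr n t.

Lemma total_powerE K t : (gr_bound t <= K)%N ->
  total_power t = \sum_(n < K) total_power_gr n t.
Proof.
move=> le_K; rewrite /total_power.
rewrite (big_ord_widen K (fun n => total_power_gr n t)) //.
rewrite [RHS](bigID (fun n : 'I_K => n < gr_bound t)%N) /=.
rewrite [X in _ = _ + X]big1 ?addr0 // => n; rewrite -leqNgt => /gr_geq_bound t0.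
rewrite /total_power_gr t0 big1 // => i _.
rewrite (linear_at0 (Sq_is_linear i)) (linear_at0 (@shift_linear _ _ _)).
exact: linear_at0 (act_linear _).
Qed.

Lemma total_power_linear : linear total_power.
Proof.
move=> a t t'.
pose K := maxn (gr_bound (a *: t + t')) (maxn (gr_bound t) (gr_bound t')).
rewrite (@total_powerE K (a *: t + t')) ?leq_maxl //.
rewrite (@total_powerE K t) ?(@total_powerE K t'); last 2 first.
- by rewrite !leq_max leqnn !orbT.
- by rewrite !leq_max leqnn !orbT.
rewrite scaler_sumr -big_split; apply: eq_bigr => i _.
exact: total_power_gr_linear.
Qed.

Lemma total_power_hom n t : homogeneous n t ->
  total_power t = \sum_(i < n.+1) 'X_ord0 ^+ (n - i) • shift (Sq i t).
Proof.
move=> tn; rewrite (@total_powerE (maxn (gr_bound t) n.+1)) ?leq_maxl //.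
have lt_n : (n < maxn (gr_bound t) n.+1)%N by rewrite leq_max leqnn orbT.
rewrite (bigD1 (Ordinal lt_n)) //= [X in _ + X]big1 ?addr0.
  by rewrite /total_power_gr tn.
move=> i; rewrite -val_eqE /= => ne_i; rewrite /total_power_gr (gr_hom i tn).
rewrite (negbTE ne_i) big1 // => j _.
rewrite (linear_at0 (Sq_is_linear j)) (linear_at0 (@shift_linear _ _ _)).
exact: linear_at0 (act_linear _).
Qed.

Lemma homogeneous_total_power n t :
  homogeneous n t -> homogeneous n.*2 (total_power t).
Proof.
move=> tn; rewrite (total_power_hom tn) /homogeneous (lin_sum (gr_is_linear _)).
apply: eq_bigr => i _; rewrite -addnn.
have -> : (n + n = (n - i) + (n + i))%N by have := ltn_ord i; lia.
by apply: homogeneous_varX; apply: homogeneous_shift; apply: homogeneous_Sq.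
Qed.

End TotalPowerDef.

Section TotalPower.
Context (M : unstableModType) (N : tensor_tower M) (s : nat).
Local Notation P := {mpoly 'F_2[s]}.
Implicit Types (p : P) (t : level N s).

Lemma total_power_var i t : total_power ('X_i • t) =
  ('X_(fintype.lift ord0 i) ^+ 2 + 'X_ord0 * 'X_(fintype.lift ord0 i)) •
    total_power t.
Proof.
have al := @act_linear M N; have tl := @total_power_linear M N.
have [K ->] := gr_fin t.
rewrite (lin_sum (al _ _)) !(lin_sum (tl _)) (lin_sum (al _ _)).
apply: eq_bigr => n _.
have tn := homogeneous_gr n t; move: (gr n t) tn => {}t tn.
rewrite (total_power_hom tn) (total_power_hom (homogeneous_var i tn)).
set v := 'X_(fintype.lift ord0 i); set u := 'X_ord0.
have SqE j : shift (Sq j.+1 ('X_i • t)) =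
    v • shift (Sq j.+1 t) + v ^+ 2 • shift (Sq j t).
  by rewrite Sq_varS (linD (@shift_linear _ _ _)) expr2 actM !shift_var -actM -expr2.
rewrite big_ord_recl subn0 Sq_var0 shift_var -/v.
under eq_bigr => j _ do rewrite [X in shift (Sq X _)]/= SqE (linD (al _ _)).
rewrite big_split (linD (@act_linearl _ _ _ _)) !(lin_sum (al _ _)).
rewrite addrA addrC; congr (_ + _).
  by apply: eq_bigr => j _; rewrite -!actM /= /bump add1n subSS mulrC.
rewrite big_ord_recr /= [Sq n.+1 t](Sq_hom_eq0 tn) //.
rewrite (linear_at0 (@shift_linear _ _ _)) !(linear_at0 (al _ _)) addr0.
rewrite [RHS]big_ord_recl; congr (_ + _).
  by rewrite -!actM subn0 exprS; congr (_ • _); rewrite mulrAC.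
apply: eq_bigr => j _; rewrite -!actM /= /bump /= !add1n subSS; congr (_ • _).
by rewrite -[(n - j)%N]prednK ?subn_gt0 ?ltn_ord // exprS subnS mulrAC.
Qed.

(** The total power of polynomials is a ring morphism, given on variables by
    St_1 x = x^2 + u x. *)
Definition dilate : P -> {mpoly 'F_2[s.+1]} :=
  subst (fun i => 'X_(fintype.lift ord0 i) ^+ 2
                  + 'X_ord0 * 'X_(fintype.lift ord0 i)).

Lemma dilate_linear : linear dilate.
Proof. exact: subst_linear. Qed.

Lemma dilateM : {morph dilate : p q / p * q}.
Proof. exact: substM. Qed.

Lemma dilate1 : dilate 1 = 1.
Proof. exact: subst1. Qed.

Lemma dilate0 : dilate 0 = 0.
Proof. exact: subst0. Qed.

Lemma dilateX i :
  dilate 'X_i = 'X_(fintype.lift ord0 i) ^+ 2 + 'X_ord0 * 'X_(fintype.lift ord0 i).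
Proof. exact: substX. Qed.

Lemma total_power_act p t : total_power (p • t) = dilate p • total_power t.
Proof.
elim/mpoly_lin_ind: p => [a p q IH IH'||i m IH].
- by rewrite act_linearl total_power_linear IH IH' dilate_linear act_linearl.
- by rewrite dilate1 !act1.
- by rewrite actM total_power_var IH dilateM dilateX actM.
Qed.

End TotalPower.

(** * Hits from powers of X + X^2 *)

Section SquarePolynomial.
Local Notation Phi := ('X + 'X ^+ 2 : {poly 'F_2}).

Lemma sqrD2 (p q : {poly 'F_2}) : (p + q) ^+ 2 = p ^+ 2 + q ^+ 2.
Proof. by rewrite sqrrD mulr2n addxx2 addr0. Qed.

Lemma exprD2 r (p q : {poly 'F_2}) :
  (p + q) ^+ (2 ^ r) = p ^+ (2 ^ r) + q ^+ (2 ^ r).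
Proof.
elim: r => [|r IH]; first by rewrite !expr1.
by rewrite expnSr !exprM IH sqrD2.
Qed.

Lemma Phi_pow2 r : Phi ^+ (2 ^ r) = 'X ^+ (2 ^ r) + 'X ^+ (2 ^ r.+1).
Proof. by rewrite exprD2 -exprM -expnS. Qed.

Definition geo n : {poly 'F_2} := \sum_(i < n) 'X ^+ i.

Lemma geoS n : geo n.+1 = 1 + 'X * geo n.
Proof.
rewrite /geo big_ord_recl expr0 mulr_sumr; congr (_ + _).
by apply: eq_bigr => i _; rewrite -exprS.
Qed.

Lemma geoD m n : geo (m + n) = geo m + 'X ^+ m * geo n.
Proof.
rewrite /geo big_split_ord mulr_sumr; congr (_ + _).
by apply: eq_bigr => i _; rewrite -exprD.
Qed.

Lemma geo_mul n : geo n * (1 + 'X) = 1 + 'X^n.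
Proof.
have := geoS n; rewrite -[n.+1 in LHS]addn1 geoD /geo !big_ord1 expr0 mulr1 -/(geo n).
move=> E; rewrite mulrDr mulr1 [geo n * 'X]mulrC.
have -> : 'X * geo n = 1 + (geo n + 'X^n) by rewrite E addrA addxx2 add0r.
by rewrite addrCA [geo n + (geo n + _)]addrA addxx2 add0r.
Qed.

Lemma Phi_pred_pow2 r : Phi ^+ (2 ^ r).-1 = 'X ^+ (2 ^ r).-1 * geo (2 ^ r).
Proof.
elim: r => [|r IH]; first by rewrite !expr0 mul1r /geo big_ord1 expr0.
have pred2 : ((2 ^ r.+1).-1 = (2 ^ r).-1 + 2 ^ r)%N.
  by have := pow2_gt0 r; rewrite expnS; lia.
rewrite pred2 exprD IH Phi_pow2 exprD -!mulrA; congr (_ * _).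
by rewrite expnS mul2n -addnn geoD exprD; ring.
Qed.

(** The total square of the sum of the X^(2^r - 1), as Phi is that of X. *)
Definition spikes R : {poly 'F_2} := \sum_(r < R) Phi ^+ (2 ^ r).-1.

(** Since Phi^(2^r) = X^(2^r) + X^(2^(r+1)), the r-th term is
    X^(2^r - 1) times a geometric series with 2^r terms: the exponents run from
    2^r - 1 to 2^(r+1) - 2, and consecutive terms fit together. *)
Lemma spikesE R : spikes R = geo (2 ^ R).-1.
Proof.
elim: R => [|R IH]; first by rewrite /spikes /geo !big_ord0.
rewrite /spikes big_ord_recr -/(spikes R) /= IH Phi_pred_pow2 -geoD; congr geo.
by have := pow2_gt0 R; rewrite expnS; lia.
Qed.

Lemma Phi_telescope a b : (a <= b)%N ->
  \sum_(a <= r < b) Phi ^+ (2 ^ r) = 'X ^+ (2 ^ a) + 'X ^+ (2 ^ b).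
Proof.
move=> /subnK <-; elim: (b - a)%N => [|n IH]; first by rewrite big_geq // addxx2.
rewrite addSn big_nat_recr ?leq_addl //= IH Phi_pow2.
by rewrite -addrA [X in _ + X]addrA addxx2 add0r.
Qed.

End SquarePolynomial.

Section Weave.
Context (M : unstableModType) (N : tensor_tower M) (s : nat).
Local Notation Phi := ('X + 'X ^+ 2 : {poly 'F_2}).
Implicit Types (y : level N s) (p : {poly 'F_2}).

(** An encoding of elements of total degree L + |y| by polynomials p in one
    variable: the monomial X^E stands for u^E ⊗ Sq^(L-E) y.  With it, identities
    between polynomials become identities between squares. *)
Definition weave L p y : level N s.+1 :=
  \sum_(E < L.+1) p`_E *: ('X_ord0 ^+ E • shift (Sq (L - E) y)).

Lemma weave_linear L y : linear (fun p => weave L p y).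
Proof.
move=> a p q; rewrite /weave scaler_sumr -big_split; apply: eq_bigr => E _.
by rewrite coefD coefZ scalerDl scalerA.
Qed.

Lemma weaveX L E y : (E <= L)%N ->
  weave L 'X^E y = 'X_ord0 ^+ E • shift (Sq (L - E) y).
Proof.
rewrite -ltnS => ltE; rewrite /weave (bigD1 (Ordinal ltE)) //= coefXn eqxx scale1r.
rewrite big1 ?addr0 // => i; rewrite -val_eqE /= coefXn => /negbTE ->.
by rewrite scale0r.
Qed.

Lemma weave_gt L E p y : (L < E)%N -> weave L ('X^E * p) y = 0.
Proof.
move=> ltLE; rewrite /weave big1 // => i _.
by rewrite coefXnM (leq_trans (ltn_ord i) ltLE) scale0r.
Qed.

Lemma coef_Phi e E : (Phi ^+ e)`_E = if (E < e)%N then 0 else 'C(e, E - e)%:R.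
Proof.
have -> : Phi ^+ e = 'X^e * (1 + 'X) ^+ e by rewrite -exprMn mulrDr mulr1 expr2.
rewrite coefXnM; case: ltnP => // _.
rewrite exprDn coef_sum; under eq_bigr => i _ do
  rewrite expr1n mul1r coefMn coefXn.
have [le_e|lt_e] := leqP (E - e) e; last first.
  rewrite bin_small // big1 // => i _; rewrite gtn_eqF ?mul0rn //.
  by apply: leq_trans lt_e; rewrite ltn_ord.
rewrite -ltnS in le_e; rewrite (bigD1 (Ordinal le_e)) //= eqxx.
rewrite big1 ?addr0 // => i; rewrite -val_eqE /= eq_sym => /negbTE ->.
by rewrite mul0rn.
Qed.

(** The source of all hits: (X + X^2)^e is the total square of X^e, so the
    Cartan formula says that it encodes a single square, a proper one if e < L. *)
Lemma weave_Phi L e y : (e <= L)%N ->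
  weave L (Phi ^+ e) y = Sq (L - e) ('X_ord0 ^+ e • shift y).
Proof.
move=> le_eL; rewrite Sq_varX /weave.
have -> : L.+1 = (e + (L - e).+1)%N by lia.
rewrite big_split_ord big1 => [|E _]; last first.
  by rewrite coef_Phi /= ltn_ord scale0r.
rewrite /= add0r; apply: eq_bigr => j _; rewrite coef_Phi /= ltnNge leq_addr /= addKn.
rewrite scaler_nat -shift_Sq; congr (_ • shift (Sq _ _) *+ _).
by have := ltn_ord j; lia.
Qed.

End Weave.

Local Notation hits := (Defs.span (@decomposable _)).

Section Hits.
Context (M : unstableModType) (N : tensor_tower M).
Local Notation Phi := ('X + 'X ^+ 2 : {poly 'F_2}).

Lemma Sq_hit (V : sqModType) k (y : V) : (0 < k)%N -> Sq k y \in hits.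
Proof.
by move=> k_gt0; apply: mem_span; exists [:: k], y; rewrite /= addn0.
Qed.

Context (s : nat).
Implicit Types (y : level N s).

Lemma weave_hit L e y : (e < L)%N -> weave L (Phi ^+ e) y \in hits.
Proof.
by move=> lt_eL; rewrite weave_Phi ?Sq_hit ?subn_gt0 // ltnW.
Qed.

(** The product u^a St_1 y is encoded by the geometric series 1 + X + ... + X^L
    with L = a + |y|; by [spikesE] it is the sum of the squares of the spikes
    u^(2^r - 1) y, up to the term X^L when that sum stops at X^(L-1). *)
Lemma total_power_spikes m a y : homogeneous m y ->
  let L := (a + m)%N in let R := up_log 2 L.+1 in
  'X_ord0 ^+ a • total_power y =
  \sum_(r < R) Sq (L - (2 ^ r).-1) ('X_ord0 ^+ (2 ^ r).-1 • shift y) +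
  (if L.+1 == (2 ^ R)%N then 'X_ord0 ^+ L • shift y else 0).
Proof.
move=> ym L R.
have lt_r (r : 'I_R) : (2 ^ r < L.+1)%N by apply: lt_up_log2.
have wl := @weave_linear M N s L y.
have <- : weave L (spikes R) y =
    \sum_(r < R) Sq (L - (2 ^ r).-1) ('X_ord0 ^+ (2 ^ r).-1 • shift y).
  rewrite (lin_sum wl); apply: eq_bigr => r _; rewrite weave_Phi //.
  by have := lt_r r; lia.
have le_LR : (L.+1 <= 2 ^ R)%N by apply: up_logP.
transitivity (weave L (geo L.+1) y).
  rewrite (total_power_hom ym) (lin_sum (act_linear _)) (lin_sum wl).
  (* By instability the exponents of u below a contribute nothing. *)
  rewrite [RHS](reindex_inj rev_ord_inj) /=.
  have le_m : (m.+1 <= L.+1)%N by rewrite ltnS leq_addl.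
  pose F i := 'X_ord0 ^+ (L - i) • shift (Sq i y).
  transitivity (\sum_(i < m.+1) F i).
    apply: eq_bigr => i _; rewrite -actM -exprD /F addnBA //.
    by rewrite -ltnS ltn_ord.
  rewrite (big_ord_widen L.+1 F le_m) big_mkcond /=; apply: eq_bigr => i _.
  rewrite subSS weaveX ?leq_subr // subKn -1?ltnS ?ltn_ord // /F.
  case: ltnP => // lt_mi; rewrite (Sq_hom_eq0 ym) //.
  by rewrite (linear_at0 (@shift_linear _ _ _)) (linear_at0 (act_linear _)).
rewrite spikesE; move: le_LR; rewrite leq_eqVlt => /orP[/eqP eqLR|lt_LR].
  rewrite -eqLR eqxx /= -[L.+1]addn1 geoD /geo big_ord1 expr0 mulr1 (linD wl).
  by rewrite weaveX // subnn Sq0_id.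
rewrite ltn_eqF // addr0.
have -> : (2 ^ R).-1 = (L.+1 + ((2 ^ R).-1 - L.+1))%N by lia.
by rewrite geoD (linD wl) weave_gt ?addr0.
Qed.

(** Let b be least with j <= 2^b.  In Phi^(2^T - 1) (1 + the sum of the
    Phi^(2^i), i < b) the first factor is X^(2^T - 1) (1 + X + X^2 + ...), while the
    second one telescopes to (1 + X) + X^(2^b).  Up to degree 2^T - 1 + j this
    leaves X^(2^T - 1), and X^(2^T - 1 + j) if j = 2^b. *)
Lemma pred_pow2_Sq T j y : (0 < j < 2 ^ T)%N ->
  'X_ord0 ^+ (2 ^ T).-1 • shift (Sq j y) +
  (if j == (2 ^ up_log 2 j)%N then
     'X_ord0 ^+ ((2 ^ T).-1 + j) • shift y else 0) \in hits.
Proof.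
move=> /andP[j_gt0 lt_jT]; set b := up_log 2 j; set L := ((2 ^ T).-1 + j)%N.
have lt_b (i : 'I_b) : (2 ^ i < j)%N by apply: lt_up_log2.
have le_jb : (j <= 2 ^ b)%N by apply: up_logP.
have wl := @weave_linear M N s L y.
have T_gt0 := pow2_gt0 T.
pose h : {poly 'F_2} := Phi ^+ (2 ^ T).-1 * (1 + \sum_(0 <= i < b) Phi ^+ (2 ^ i)).
have h_hit : weave L h y \in hits.
  rewrite /h mulrDr mulr1 mulr_sumr (linD wl) (lin_sum wl) big_mkord.
  apply: rpredD; first by apply: weave_hit; rewrite /L; lia.
  by apply: rpred_sum => i _; rewrite -exprD; apply: weave_hit; rewrite ltn_add2l.
rewrite [X in X \in _](_ : _ = weave L h y) //.
rewrite /h Phi_telescope // expr1 Phi_pred_pow2 addrA.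
rewrite mulrDr -mulrA geo_mul mulrDr mulr1 -exprD !(linD wl).
rewrite -['X^(_ + 2 ^ T)]mulr1 weave_gt ?addr0; last by rewrite /L; lia.
rewrite weaveX ?leq_addr // [in RHS]/L addKn; congr (_ + _).
have geoE : geo (2 ^ T) = 1 + 'X * geo (2 ^ T).-1 by rewrite -geoS prednK.
rewrite mulrAC -exprD geoE mulrDr mulr1 mulrA -exprSr (linD wl).
move: le_jb; rewrite leq_eqVlt => /orP[/eqP jE|lt_jb].
  by rewrite {1}jE eqxx -jE -/L weaveX // subnn Sq0_id weave_gt // addr0.
rewrite ltn_eqF // -['X^(_ + 2 ^ b)]mulr1 !weave_gt ?addr0 // /L; lia.
Qed.

(** Sum the squares of u^(2^r) u^(2^i - 1) over i <= a < r <= T.  The powers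
    Phi^(2^r) telescope to X^(2^(a+1)) + X^(2^(T+1)) and the spikes to a geometric
    series; the square of u^(2^(a+1) - 1) cancels the part of the product that
    starts with X^(2^(a+1)) and leaves its own lowest term.  The pair r = T, i = a
    is the one that is not hit. *)
Lemma pow2_spike_transfer T a y : (a < T)%N ->
  'X_ord0 ^+ (2 ^ T + (2 ^ a).-1) • shift y +
  'X_ord0 ^+ (2 ^ a.+1).-1 • shift (Sq (2 ^ T - 2 ^ a) y) \in hits.
Proof.
move=> lt_aT; set L := (2 ^ T + (2 ^ a).-1)%N.
have wl := @weave_linear M N s L y.
have a_gt0 := pow2_gt0 a; have a1_gt0 := pow2_gt0 a.+1.
have le_aT : (2 ^ a.+1 <= 2 ^ T)%N by rewrite leq_exp2l.
have a1E : (2 ^ a.+1 = 2 ^ a + 2 ^ a)%N by rewrite expnS mul2n addnn.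
pose h : {poly 'F_2} := (\sum_(a.+1 <= r < T) Phi ^+ (2 ^ r)) * spikes a.+1
  + Phi ^+ (2 ^ T) * spikes a + Phi ^+ (2 ^ a.+1).-1.
have h_hit : weave L h y \in hits.
  rewrite !(linD wl); apply: rpredD; first apply: rpredD.
  - rewrite big_nat mulr_suml (lin_sum wl); apply: rpred_sum => r /andP[_ lt_rT].
    rewrite mulr_sumr (lin_sum wl); apply: rpred_sum => i _.
    rewrite -exprD; apply: weave_hit; rewrite /L.
    have : (2 ^ i <= 2 ^ a)%N by rewrite leq_exp2l // -ltnS.
    have : (2 ^ r < 2 ^ T)%N by rewrite ltn_exp2l.
    by have := pow2_gt0 i; lia.
  - rewrite mulr_sumr (lin_sum wl); apply: rpred_sum => i _.
    rewrite -exprD; apply: weave_hit; rewrite ltn_add2l.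
    have : (2 ^ i < 2 ^ a)%N by rewrite ltn_exp2l.
    by have := pow2_gt0 i; lia.
  - by apply: weave_hit; rewrite /L; lia.
have hE : h + Phi ^+ L = 'X^((2 ^ a.+1).-1) + 'X^((2 ^ T.+1)%N) * geo (2 ^ a.+1).-1.
  have -> : h + Phi ^+ L = (\sum_(a.+1 <= r < T.+1) Phi ^+ (2 ^ r)) * spikes a.+1
      + Phi ^+ (2 ^ a.+1).-1.
    rewrite big_nat_recr //= /h /L exprD.
    have -> : spikes a.+1 = spikes a + Phi ^+ (2 ^ a).-1.
      by rewrite /spikes big_ord_recr.
    move: (\sum_(_ <= _ < _) _) (Phi ^+ (2 ^ T)) (Phi ^+ (2 ^ a).-1).
    by move: (spikes a) (Phi ^+ _) => S Q A B R; ring.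
  rewrite Phi_telescope 1?ltnW // spikesE Phi_pred_pow2.
  rewrite -[in geo (2 ^ a.+1)](prednK a1_gt0) geoS mulrDr mulr1 mulrA -exprSr.
  rewrite prednK // mulrDl.
  by rewrite addrC -addrA; congr (_ + _); rewrite addrA addxx2 add0r.
have wL : weave L (Phi ^+ L) y = 'X_ord0 ^+ L • shift y.
  by rewrite weave_Phi // subnn Sq0_id.
have := congr1 (fun p => weave L p y) hE; rewrite /= (linD wl h) wL (linD wl 'X^_).
rewrite weave_gt; last by rewrite expnS /L; lia.
rewrite addr0 weaveX /L; last by lia.
have -> : (2 ^ T + (2 ^ a).-1 - (2 ^ a.+1).-1 = 2 ^ T - 2 ^ a)%N by lia.
by move=> <-; rewrite addrCA addxx2 addr0.
Qed.

(** If j = 2^b is a power of two, Sq^j y is traded for u^j by [pred_pow2_Sq],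
    then for the square of y of degree 2^T - 2^b by [pow2_spike_transfer], which
    exceeds |y|. *)
Lemma pred_pow2_Sq_hit T j n y : homogeneous n y -> (0 < j)%N -> (n + j < 2 ^ T)%N ->
  'X_ord0 ^+ (2 ^ T).-1 • shift (Sq j y) \in hits.
Proof.
move=> yn j_gt0 lt_njT.
have j_bd : (0 < j < 2 ^ T)%N by rewrite j_gt0 (leq_ltn_trans (leq_addl n j)).
have := pred_pow2_Sq y j_bd; set b := up_log 2 j; case: eqP => [jE|_]; last first.
  by rewrite addr0.
have lt_bT : (b < T)%N by rewrite -(@ltn_exp2l 2) // -jE; case/andP: j_bd.
have := pow2_spike_transfer y lt_bT.
rewrite (@Sq_hom_eq0 _ _ _ _ n) //; last by rewrite -jE; lia.
rewrite (linear_at0 (@shift_linear _ _ _)) (linear_at0 (act_linear _)) addr0.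
rewrite [X in 'X_ord0 ^+ X • _ \in _ -> _](_ : _ = ((2 ^ T).-1 + j)%N); last first.
  by rewrite -jE; have := pow2_gt0 T; lia.
by move=> hit; rewrite (rpredDr _ hit).
Qed.

End Hits.

(** * Invariants of two variables turn total powers into hits *)

(** Applying the rule of Pascal twice gives, modulo 2, the same rule with steps
    of two, so that rows of equal parity behave as rows of half the index. *)
Lemma odd_bin n k :
  odd 'C(n, k) = (odd k ==> odd n) && odd 'C(n./2, k./2).
Proof.
elim/ltn_ind: n k => -[|[|n]] IH k.
- by case: k => [|[|k]]; rewrite ?bin0n //= andbF.
- by case: k => [|[|k]] //; rewrite !bin_small //= andbF.
case: k => [|[|k]]; first by rewrite !bin0.
  by rewrite bin1 /= ?bin0 ?andbT.
have half2 m : (m.+2)./2 = (m./2).+1 by [].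
have odd2 m : odd m.+2 = odd m by rewrite /= negbK.
rewrite !half2 !odd2 !binS !oddD.
have -> : odd 'C(n, k.+2) (+) odd 'C(n, k.+1) (+) (odd 'C(n, k.+1) (+) odd 'C(n, k))
  = odd 'C(n, k.+2) (+) odd 'C(n, k) by case: odd; case: odd; case: odd.
have lt_n : (n < n.+2)%N by rewrite ltnS ltnW.
by rewrite !(IH n lt_n) half2 odd2; case: (odd k ==> odd n).
Qed.

(** If q choose k is odd, the binary digits of q - k are those of q that are not
    digits of k.  Reading 2(q - k) = k + 1 modulo 2^i from the lowest digit
    upwards, k is odd, hence so is q, hence q - k is even, and halving all of them
    repeats the situation: the i lowest digits of k are ones. *)
Lemma odd_bin_dvd i q k : odd 'C(q, k) ->
  ((q - k).*2 = k.+1 %[mod 2 ^ i])%N -> (2 ^ i %| k.+1)%N.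
Proof.
elim: i q k => [|i IH] q k oddC; first by rewrite dvd1n.
have le_kq : (k <= q)%N by rewrite leqNgt; apply: contraTN oddC => /bin_small ->.
move=> eq_mod; have k_odd : odd k.
  have := congr1 (modn^~ 2) eq_mod; rewrite /= !modn_dvdm ?dvdn_exp //.
  by rewrite !modn2 odd_double /=; case: odd.
move: oddC; rewrite odd_bin k_odd /= => /andP[q_odd oddC].
have kE : (k.+1 = 2 * k./2.+1)%N by have := odd_double_half k; rewrite k_odd; lia.
have qkE : ((q - k).*2 = 2 * (q./2 - k./2).*2)%N.
  by have := odd_double_half k; have := odd_double_half q; rewrite k_odd q_odd; lia.
rewrite kE expnS dvdn_pmul2l //; apply: IH oddC _.
apply/eqP; move/eqP: eq_mod; rewrite kE qkE expnS -!muln_modr.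
by rewrite eqn_pmul2l.
Qed.

Section TwoVariables.
Context (M : unstableModType) (N : tensor_tower M) (r : nat).
Local Notation P := {mpoly 'F_2[r.+2]}.

(** The outer sum of squares is hit unless a + |y| + 1 = 2^T; what then remains is
    the spike u^(2^T - 1) times y, itself a sum of squares in the inner variable.
    These are proper by the assumption on c, and of degree |y| = 2^T - 1 - a, within
    the reach of [pred_pow2_Sq_hit]. *)
Lemma iterated_power_hit a c n (z : level N r) : homogeneous n z ->
  (forall T j, (a + (c + n.*2)).+1 = (2 ^ T)%N -> (c + n).+1 <> (2 ^ j)%N) ->
  'X_ord0 ^+ a • total_power ('X_ord0 ^+ c • total_power z) \in hits.
Proof.
move=> zn pow2F; set y := _ ^+ c • _.
have ym : homogeneous (c + n.*2) y.
  by apply: homogeneous_varX; apply: homogeneous_total_power.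
rewrite (total_power_spikes a ym); apply: rpredD.
  apply: rpred_sum => i _; apply: Sq_hit.
  by have := lt_up_log2 (ltn_ord i); have := pow2_gt0 i; lia.
case: eqP => [LE|_]; last exact: rpred0.
have -> : (a + (c + n.*2) = (2 ^ up_log 2 (a + (c + n.*2)).+1).-1)%N by rewrite -LE.
rewrite /y (total_power_spikes c zn); case: eqP => [/(pow2F _ _ LE) //|_].
rewrite addr0 (lin_sum (@shift_linear _ _ _)) (lin_sum (act_linear _)).
apply: rpred_sum => i _.
have := lt_up_log2 (ltn_ord i); have := pow2_gt0 i => i_gt0 lt_i.
apply: (@pred_pow2_Sq_hit _ _ _ _ _ ((2 ^ i).-1 + n)).
- by apply: homogeneous_varX; apply: homogeneous_shift.
- by lia.
- by rewrite -LE; lia.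
Qed.

(** As the total power of v is v^2 + uv, these are uv(u + v) and u^2 + uv + v^2;
    the form below is the one to which [total_power_act] applies. *)
Definition dickson2_0 : P := 'X_ord0 * dilate 'X_ord0.
Definition dickson2_1 : P := 'X_ord0 ^+ 2 + dilate 'X_ord0.

(** In the expansion of q0^p q1^q the k-th term has a = p + 2(q - k) and
    c = p + k.  If a + c + 2n + 1 = 2^T and c + n + 1 = 2^j, subtracting twice the
    second from the first gives 2(q - k) = k + 1 modulo 2^(j+1), as j < T because
    n > 0.  For an odd coefficient, 2^(j+1) then divides k + 1 <= c + n + 1 = 2^j. *)
Lemma dickson2_pow_hit p q n (z : level N r) : (0 < n)%N -> homogeneous n z ->
  (dickson2_0 ^+ p * dickson2_1 ^+ q) • total_power (total_power z) \in hits.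
Proof.
move=> n_gt0 zn; set t := total_power (total_power z).
have dX k : dilate ('X_ord0 ^+ k : {mpoly 'F_2[r.+1]}) = dilate 'X_ord0 ^+ k.
  by elim: k => [|k IH]; rewrite ?dilate1 // !exprS dilateM IH.
have -> : dickson2_0 ^+ p * dickson2_1 ^+ q = \sum_(k < q.+1)
    ('X_ord0 ^+ (p + 2 * (q - k)) * dilate ('X_ord0 ^+ (p + k))) *+ 'C(q, k).
  rewrite /dickson2_1 exprDn mulr_sumr; apply: eq_bigr => k _.
  rewrite mulrnAr exprMn -exprM dX !exprD; congr (_ *+ _).
  by rewrite mulrACA.
rewrite (lin_sum (act_linearl _)); apply: rpred_sum => k _.
rewrite (linMn (act_linearl _)) mulrn_odd.
case: ifP => [oddC|_]; last exact: rpred0.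
rewrite actM -total_power_act; apply: iterated_power_hit zn _ => T j LE jE.
have le_kq : (k <= q)%N by rewrite -ltnS.
have lt_jT : (j < T)%N by rewrite -(@ltn_exp2l 2) // -jE -LE; lia.
suff : (2 ^ j.+1 %| k.+1)%N by move/dvdn_leq => /(_ isT); rewrite expnS -jE; lia.
apply: odd_bin_dvd oddC _.
have : (2 ^ j.+1 %| 2 ^ T)%N by rewrite dvdn_exp2l.
rewrite -LE => /dvdnP[w wE].
case: w wE => [//|w] wE.
have -> : ((q - k).*2 = w * 2 ^ j.+1 + k.+1)%N.
  by move: wE; rewrite mulSn expnS -jE; lia.
by rewrite modnMDl.
Qed.

End TwoVariables.

(** * Degrees and square roots *)

Section Degree.
Context (s : nat).
Implicit Types p q : {mpoly 'F_2[s]}.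

Lemma msize_lin n a p q :
  (msize p <= n)%N -> (msize q <= n)%N -> (msize (a *: p + q) <= n)%N.
Proof.
move=> le_p le_q; apply: leq_trans (msizeD_le _ _) _.
by rewrite geq_max le_q andbT (leq_trans (msizeZ_le _ _)).
Qed.

Lemma msize_mul m n p q : (msize p <= m.+1)%N -> (msize q <= n.+1)%N ->
  (msize (p * q) <= (m + n).+1)%N.
Proof.
have [->|p0] := eqVneq p 0; first by rewrite mul0r msize0.
have [->|q0] := eqVneq q 0; first by rewrite mulr0 msize0.
move=> le_p le_q; rewrite msizeM // -subn1 leq_subLR.
by apply: leq_trans (leq_add le_p le_q) _; lia.
Qed.

Lemma msize_exp m n p : (msize p <= m.+1)%N -> (msize (p ^+ n) <= (n * m).+1)%N.
Proof.
move=> le_p; elim: n => [|n IH]; first by rewrite expr0 msize1.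
by rewrite exprS mulSn msize_mul.
Qed.

End Degree.

Lemma msize_subst s t (h : 'I_s -> {mpoly 'F_2[t]}) k n p :
  (forall i, msize (h i) <= k.+1)%N -> (msize p <= n.+1)%N ->
  (msize (subst h p) <= (k * n).+1)%N.
Proof.
move=> le_h le_p; rewrite [p]mpolyE (lin_sum (subst_linear h)) big_seq.
apply: (big_ind (fun q => msize q <= (k * n).+1)%N) => [|q q' le_q le_q'|m mp].
- by rewrite msize0.
- by rewrite -[q]scale1r msize_lin.
have -> : subst h (p@_m *: 'X_[m]) = p@_m *: subst h 'X_[m].
  by rewrite /subst linearZ.
apply: leq_trans (msizeZ_le _ _) _.
have le_m : (mdeg m <= n)%N by have := leq_trans (msize_mdeg_lt mp) le_p.
apply: (@leq_trans (k * mdeg m).+1); last by rewrite ltnS leq_mul2l le_m orbT.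
elim/monomial_ind: m {mp le_m} => [|m i IH].
  by rewrite mpolyX0 subst1 msize1.
by rewrite mpolyXD substM substX mdegD mdeg1 mulnDr muln1 msize_mul.
Qed.

Section SquareRoot.
Context (s : nat).
Implicit Types p q : {mpoly 'F_2[s]}.

(** A monomial with an odd exponent survives in some derivative, and the
    coefficients, being 0 or 1, are their own square roots.  The second conclusion
    says twice deg q <= deg p, in a form that makes sense for q = 0. *)
Lemma deriv0_square p : (forall i, mderiv i p = 0) ->
  exists2 q, p = q ^+ 2 & forall n, (msize p <= n.+1)%N -> (2 * (msize q).-1 <= n)%N.
Proof.
move=> dp.
have even_p m : m \in msupp p -> forall i, ~~ odd (m i).
  rewrite mcoeff_msupp => pm i; apply/negP => m_odd.
  have le_m : (U_(i) <= m)%MM by rewrite lep1mP -lt0n; case: (m i) m_odd.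
  have := congr1 (mcoeff (m - U_(i))%MM) (dp i).
  rewrite mcoeff_mderiv submK // mcoeff0 mnmBE mnm1E eqxx subn1.
  rewrite prednK; last by case: (m i) m_odd.
  by rewrite (@mulrn_odd ('F_2)^o) m_odd; apply/eqP.
pose half m : 'X_{1..s} := [multinom (m i)./2 | i < s].
have halfE m : m \in msupp p -> (half m + half m)%MM = m.
  move=> mp; apply/mnmP => i; rewrite mnmDE mnmE addnn.
  by rewrite -[RHS]odd_double_half (negbTE (even_p m mp i)).
exists (\sum_(m <- msupp p) p@_m *: 'X_[half m]).
  rewrite [LHS]mpolyE.
  rewrite (big_morph (fun q => q ^+ 2) (@sqrD_mpoly s) (expr0n _ _)) !big_seq.
  apply: eq_bigr => m mp; rewrite exprZn F2_sqr; congr (_ *: _).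
  by rewrite -{1}(halfE m mp) mpolyXD expr2.
move=> n le_p; suff : (msize (\sum_(m <- msupp p) p@_m *: 'X_[half m]) <= n./2.+1)%N.
  by have := odd_double_half n; lia.
rewrite big_seq.
apply: (big_ind (fun q => msize q <= n./2.+1)%N) => [|q q' le_q le_q'|m mp].
- by rewrite msize0.
- by rewrite -[q]scale1r msize_lin.
apply: leq_trans (msizeZ_le _ _) _; rewrite msizeX ltnS.
have := leq_trans (msize_mdeg_lt mp) le_p; rewrite -{1}(halfE m mp) mdegD.
by have := odd_double_half n; lia.
Qed.

End SquareRoot.

(** * Transvections and restriction to u = 0 *)

Lemma msize_var s (i : 'I_s) : msize ('X_i : {mpoly 'F_2[s]}) = 2%N.
Proof. by rewrite msizeX mdeg1. Qed.

Lemma var_neq0 s (i : 'I_s) : 'X_i != 0 :> {mpoly 'F_2[s]}.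
Proof. by rewrite -msize_poly_eq0 msize_var. Qed.

Section Transvections.

Definition transvection s (i j : 'I_s) :=
  subst (fun k => if k == i then 'X_i + 'X_j else 'X_k : {mpoly 'F_2[s]}).

(** The matrix of a transvection is its own inverse. *)
Lemma dickson_transvection s (f : {mpoly 'F_2[s]}) (i j : 'I_s) :
  f \in dickson s -> i != j -> transvection i j f = f.
Proof.
move=> /forallP /(_ (1%:M + delta_mx i j)) /implyP inv ij.
have g_unit : 1%:M + delta_mx i j \in @unitmx 'F_2 s.
  apply: (@mulmx1_unit _ _ _ (1%:M + delta_mx i j) _).1.
  rewrite mulmxDr mulmx1 mulmxDl mul1mx mul_delta_mx_0 1?eq_sym // addr0.
  by rewrite -addrA addxx2 addr0.
rewrite -[RHS](eqP (inv g_unit)); apply: eq_subst => k /=.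
under eq_bigr => l _ do rewrite !mxE scalerDl.
rewrite big_split /= (bigD1 k) //= eqxx scale1r big1 ?addr0; last first.
  by move=> l lk; rewrite eq_sym (negbTE lk) scale0r.
case: eqP => [->|_] /=; last first.
  by rewrite big1 ?addr0 // => l _; rewrite scale0r.
rewrite (bigD1 j) //= eqxx scale1r big1 ?addr0 // => l lj.
by rewrite (negbTE lj) scale0r.
Qed.

Context (s : nat).
Implicit Types (i j k : 'I_s) (p q : {mpoly 'F_2[s]}).

Lemma transvectionX i j k :
  transvection i j 'X_k = if k == i then 'X_i + 'X_j else 'X_k.
Proof. exact: substX. Qed.

Lemma transvectionX_neq i j k : k != i -> transvection i j 'X_k = 'X_k.
Proof. by rewrite transvectionX => /negbTE ->. Qed.

Lemma transvectionX_eq i j : transvection i j 'X_i = 'X_i + 'X_j.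
Proof. by rewrite transvectionX eqxx. Qed.

(** The exchange of two variables is a product of three transvections. *)
Definition transposition i j p :=
  transvection i j (transvection j i (transvection i j p)).

Lemma transpositionE i j p : i != j -> transposition i j p =
  subst (fun k => if k == i then 'X_j else if k == j then 'X_i else 'X_k) p.
Proof.
move=> ij; have ji : j != i by rewrite eq_sym.
rewrite /transposition /transvection !subst_comp; apply: eq_subst => k.
case: (eqVneq k i) => [kE|ki]; last case: (eqVneq k j) => [kE|kj].
- do ! rewrite ?(substD, substX, eqxx, negbTE ij, negbTE ji) /=.
  by rewrite addrCA addxx2 addr0.
- do ! rewrite ?(kE, substD, substX, eqxx, negbTE ij, negbTE ji) /=.
  by rewrite addrCA addxx2 addr0.
- by rewrite !(substX, negbTE ki, negbTE kj).
Qed.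

End Transvections.

(** For derivations along a ring morphism R, such as f -> (df/du)(0, x), not only
    for derivations of the ring itself. *)
Lemma derivation_ext s t (R D D' : {mpoly 'F_2[s]} -> {mpoly 'F_2[t]}) :
  linear D -> linear D' ->
  (forall p q, D (p * q) = D p * R q + R p * D q) ->
  (forall p q, D' (p * q) = D' p * R q + R p * D' q) ->
  (forall i, D 'X_i = D' 'X_i) -> D =1 D'.
Proof.
move=> Dl Dl' DM DM' DX; elim/mpoly_lin_ind => [a p q IH IH'||i m IH].
- by rewrite Dl Dl' IH IH'.
- have D1 (F : {mpoly 'F_2[s]} -> {mpoly 'F_2[t]}) :
      (forall p q, F (p * q) = F p * R q + R p * F q) -> F 1 = 0.
    move=> FM; have := FM 1 1; rewrite mulr1 [R 1 * _]mulrC.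
    by rewrite addxx2.
  by rewrite !D1.
- by rewrite DM DM' DX IH.
Qed.

Section Restriction.
Context (s : nat).
Local Notation lift0 := (fintype.lift ord0).

Definition restrict : {mpoly 'F_2[s.+1]} -> {mpoly 'F_2[s]} :=
  subst (fun k => if unlift ord0 k is Some l then 'X_l else 0).

Lemma restrict_linear : linear restrict.
Proof. exact: subst_linear. Qed.

Lemma restrictM : {morph restrict : p q / p * q}.
Proof. exact: substM. Qed.

Lemma restrict1 : restrict 1 = 1.
Proof. exact: subst1. Qed.

Lemma restrict0 : restrict 0 = 0.
Proof. exact: subst0. Qed.

Lemma restrictX0 : restrict 'X_ord0 = 0.
Proof. by rewrite /restrict substX unlift_none. Qed.

Lemma restrictX (k : 'I_s) : restrict 'X_(lift0 k) = 'X_k.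
Proof. by rewrite /restrict substX liftK. Qed.

Lemma restrict_eq0 p : restrict p = 0 -> exists q, p = 'X_ord0 * q.
Proof.
suff [q E] : exists q, p = last_vars (restrict p) + 'X_ord0 * q.
  by move=> p0; exists q; rewrite {1}E p0 [last_vars _]subst0 add0r.
elim/mpoly_lin_ind: p => [a p p' [q E] [q' E']||k m [q E]].
- exists (a *: q + q'); rewrite {1}E {1}E' (restrict_linear a).
  rewrite [last_vars (_ + _)](subst_linear _ a) scalerDr addrACA.
  by rewrite mulrDr scalerAr.
- by exists 0; rewrite restrict1 mulr0 addr0 [last_vars _]subst1.
- rewrite restrictM; case: (unliftP ord0 k) => [l|] ->.
    rewrite restrictX; exists ('X_(lift0 l) * q).
    rewrite [last_vars _]substM [subst _ 'X_l]substX {1}E mulrDr; congr (_ + _).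
    by rewrite mulrCA.
  exists 'X_[m]; rewrite restrictX0 mul0r [last_vars _]subst0 add0r //.
Qed.

Lemma restrict_transvection (i j : 'I_s) p :
  restrict (transvection (lift0 i) (lift0 j) p) = transvection i j (restrict p).
Proof.
rewrite /restrict /transvection !subst_comp; apply: eq_subst => k.
case: (unliftP ord0 k) => [l|] ->; last by rewrite substX unlift_none subst0.
rewrite [RHS]substX (inj_eq lift_inj).
case: eqP => _; last by rewrite substX liftK.
by rewrite substD !substX !liftK.
Qed.

Lemma restrict_transvection0 (k : 'I_s) p :
  restrict (transvection (lift0 k) ord0 p) = restrict p.
Proof.
rewrite /restrict /transvection !subst_comp; apply: eq_subst => l.
case: eqP => [->|_]; last by rewrite substX.
by rewrite substD !substX liftK unlift_none addr0.
Qed.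

(** The chain rule for u -> f(u, ..., x_k + u, ...) at u = 0. *)
Lemma restrict_deriv_transvection (k : 'I_s) p :
  restrict (mderiv ord0 (transvection (lift0 k) ord0 p)) =
  restrict (mderiv ord0 p) + mderiv k (restrict p).
Proof.
have dX m (i j : 'I_m) : mderiv i ('X_j : {mpoly 'F_2[m]}) = (i == j)%:R.
  rewrite mderivX mnm1E eq_sym; case: eqP => [->|_]; last by rewrite scale0r.
  by rewrite scale1r -{1}[U_(j)%MM]add0m addmK mpolyX0.
pose E := transvection (lift0 k) ord0.
have El : linear E by exact: subst_linear.
have EM : {morph E : p q / p * q} by exact: substM.
have E_res p' : restrict (E p') = restrict p' by exact: restrict_transvection0.
have EX i : E 'X_i = if i == lift0 k then 'X_i + 'X_ord0 else 'X_i.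
  by rewrite /E transvectionX; case: eqP => [->|].
rewrite -/E; move: E El EM E_res EX => E El EM E_res EX.
have := restrict_linear; have := restrictM; have := restrictX; have := restrictX0.
have := restrict1; move: restrict E_res => R E_res R1 RX0 RX RM Rl.
have dl m (i : 'I_m) : linear (@mderiv m 'F_2 i) by exact: mderiv_is_linear.
move: p; apply: (@derivation_ext _ _ R (fun p => R (mderiv ord0 (E p)))
  (fun p => R (mderiv ord0 p) + mderiv k (R p))) => [||p q|p q|i].
- exact: lin_comp Rl (lin_comp (dl _ _) El).
- exact: lin_add (lin_comp Rl (dl _ _)) (lin_comp (dl _ _) Rl).
- by rewrite EM mderivM (linD Rl) !RM !E_res.
- rewrite mderivM (linD Rl) !RM mderivM mulrDl mulrDr.
  by rewrite addrACA.
- rewrite EX; case: (unliftP ord0 i) => [l|] ->; last first.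
    by rewrite (negbTE (neq_lift ord0 k)) RX0 mderiv0 addr0.
  rewrite RX (inj_eq lift_inj); have [->|/negbTE lk] := altP (l =P k); last first.
    by rewrite !dX (eq_sym k) lk addr0.
  by rewrite mderivD (linD Rl) !dX !eqxx R1.
Qed.

(** For an invariant p, the two derivatives along u in
    [restrict_deriv_transvection] agree, so the derivatives along the x_k vanish. *)
Lemma restrict_square p :
  (forall k, transvection (lift0 k) ord0 p = p) ->
  exists2 q, restrict p = q ^+ 2 &
    forall n, (msize p <= n.+1)%N -> (2 * (msize q).-1 <= n)%N.
Proof.
move=> p_inv; have [|q pE le_q] := @deriv0_square s (restrict p).
  move=> k; have := restrict_deriv_transvection k p; rewrite p_inv.
  by move/eqP; rewrite eq_sym -subr_eq0 addrC addKr => /eqP.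
exists q => // n le_p; apply: le_q.
rewrite -[n]mul1n; apply: msize_subst => // i.
by case: unlift => [l|]; rewrite ?msize0 ?msizeX ?mdeg1.
Qed.

(** Hence squares lift along [restrict] to invariants of the translations by u. *)
Lemma restrict_dilate p : restrict (dilate p) = p ^+ 2.
Proof.
rewrite sqr_subst /restrict /dilate subst_comp.
apply: eq_subst => k.
by rewrite substD substXn substM !substX liftK unlift_none mul0r addr0.
Qed.

Lemma transvection_dilate (k : 'I_s) p :
  transvection (lift0 k) ord0 (dilate p) = dilate p.
Proof.
rewrite /transvection /dilate subst_comp; apply: eq_subst => l.
rewrite substD substXn substM !substX (inj_eq lift_inj) (negbTE (neq_lift _ _)).
case: eqP => [->|//]; rewrite sqrD_mpoly mulrDr -expr2 addrACA.
by rewrite addxx2 addr0.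
Qed.

Lemma msize_dilate n (p : {mpoly 'F_2[s]}) :
  (msize p <= n.+1)%N -> (msize (dilate p) <= (2 * n).+1)%N.
Proof.
apply: msize_subst => i; rewrite -['X_(lift0 i) ^+ 2]scale1r.
have mX (k : 'I_s.+1) : (msize ('X_k : {mpoly 'F_2[s.+1]}) <= 1.+1)%N.
  by rewrite msizeX mdeg1.
by apply: msize_lin; [exact: (msize_exp (m := 1) 2) | exact: (msize_mul (m := 1) (n := 1))].
Qed.

Lemma msize_var_mul n (p : {mpoly 'F_2[s.+1]}) :
  (msize ('X_ord0 * p) <= n.+1)%N -> (msize p <= n)%N.
Proof.
have [->|p0] := eqVneq p 0; first by rewrite msize0.
by rewrite msizeM ?var_neq0 // msize_var.
Qed.

End Restriction.

Section TranslationInvariants.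
Context (s : nat).
Local Notation P := {mpoly 'F_2[s.+1]}.
Local Notation lift0 := (fintype.lift ord0).

(** Products u^i St_1 h of degree at most n, the degree of h being
    [(msize h).-1]. *)
Definition dilate_term n (f : P) := exists i (h : {mpoly 'F_2[s]}),
  (i + 2 * (msize h).-1 <= n)%N /\ f = 'X_ord0 ^+ i * dilate h.

(** The restriction of f to u = 0 is a square g^2, and the total power of g is an
    invariant with the same restriction.  The difference is divisible by u, and the
    quotient is an invariant of lower degree. *)
Lemma translation_invariant n (f : P) : (msize f <= n.+1)%N ->
  (forall k, transvection (lift0 k) ord0 f = f) ->
  f \in Defs.span (dilate_term n).
Proof.
elim/ltn_ind: n f => n IH f le_f f_inv.
have [g fE le_g] := restrict_square f_inv.
have [|q qE] := @restrict_eq0 s (f - dilate g).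
  by rewrite (linB (@restrict_linear s)) fE restrict_dilate subrr.
have f_split : f = dilate g + 'X_ord0 * q by rewrite -qE addrC subrK.
have {}le_g := le_g n le_f.
rewrite f_split; apply: rpredD.
  by apply: mem_span; exists 0%N, g; rewrite expr0 mul1r.
have le_q : (msize q <= n)%N.
  apply: msize_var_mul; rewrite -qE -scaleN1r addrC; apply: msize_lin => //.
  have [m0|m0] := posnP (msize g).
    have -> : g = 0 by apply/eqP; rewrite -msize_poly_eq0 m0.
    by rewrite dilate0 msize0.
  have : (msize g <= (msize g).-1.+1)%N by rewrite prednK.
  by move/msize_dilate/leq_trans; apply.
case: n => [|n] in IH le_f le_g le_q *.
  have -> : q = 0 by apply/eqP; rewrite -msize_poly_eq0 -leqn0.
  by rewrite mulr0 rpred0.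
have q_inv k : transvection (lift0 k) ord0 q = q.
  apply: (@mulfI _ ('X_ord0 : P)); first by rewrite var_neq0.
  rewrite -{1}(@transvectionX_neq _ (lift0 k) ord0 ord0) ?neq_lift //.
  rewrite -[LHS]substM -/(transvection _ _ _) -qE.
  by rewrite [LHS](linB (subst_linear _)) -!/(transvection _ _ _) f_inv transvection_dilate.
have /asboolP[r [rG ->]] := IH n (ltnSn n) q le_q q_inv.
rewrite mulr_sumr big_seq; apply: rpred_sum => x /rG [i [h [le_ih ->]]].
rewrite -scalerAr mulrA -exprS; apply: rpredZ; apply: mem_span.
by exists i.+1, h.
Qed.

End TranslationInvariants.

(** * Invariants of the group generated by transvections along u and v *)

Lemma span_ind (V : lmodType 'F_2) (G Q : V -> Prop) :
  Q 0 -> (forall a x y, Q x -> Q y -> Q (a *: x + y)) ->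
  (forall x, G x -> Q x) -> forall x, x \in Defs.span G -> Q x.
Proof.
move=> Q0 QD QG x /asboolP[r [rG ->]]; rewrite big_seq.
apply: (big_ind Q) => // [y z Qy Qz|y /rG /QG Qy].
  by rewrite -[y]scale1r; apply: QD.
by rewrite -[_ *: _]addr0; apply: QD.
Qed.

Lemma sqr_mpoly_inj s : injective (fun p : {mpoly 'F_2[s]} => p ^+ 2).
Proof.
move=> p q /= pq; have : (p + q) ^+ 2 = 0 by rewrite sqrD_mpoly pq addxx2.
move/eqP; rewrite expf_eq0 /= => /eqP pq0.
by rewrite -[p]addr0 -(addxx2 q) addrA pq0 add0r.
Qed.

Section Parabolic.
Context (r : nat).
Local Notation P := {mpoly 'F_2[r.+2]}.
Local Notation lift0 := (fintype.lift ord0).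
Local Notation i0 := (ord0 : 'I_r.+2).
Local Notation i1 := (lift0 ord0 : 'I_r.+2).
Local Notation u := ('X_i0 : P).
Local Notation v := ('X_i1 : P).
Local Notation q0 := (dickson2_0 r).
Local Notation q1 := (dickson2_1 r).

(** The transvections adding u or v to a variable suffice for the decomposition;
    unlike all of GL, the group that they generate also fixes the twofold total
    power of every polynomial h. *)
Definition parabolic_invariant (f : P) :=
  forall i j : 'I_r.+2, i != j -> (j < 2)%N -> transvection i j f = f.

Lemma transvection_lift_dilate s (i j : 'I_s) (p : {mpoly 'F_2[s]}) :
  transvection (lift0 i) (lift0 j) (dilate p) = dilate (transvection i j p).
Proof.
rewrite /dilate /transvection !subst_comp; apply: eq_subst => k.
rewrite substD substXn substM !substX (inj_eq lift_inj).
rewrite (negbTE (neq_lift ord0 i)).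
case: eqP => [_|_]; last by rewrite substX.
by rewrite substD !substX sqrD_mpoly mulrDr addrACA.
Qed.

Lemma dilate_X0 : dilate ('X_ord0 : {mpoly 'F_2[r.+1]}) = v ^+ 2 + u * v.
Proof. exact: dilateX. Qed.

(** In this form [ring] proves identities modulo 2: the witness c collects one half
    of the terms that cancel in pairs. *)
Lemma mod2_eq (p q c : P) : p = q + (c + c) -> p = q.
Proof. by move=> ->; rewrite addxx2 addr0. Qed.

Lemma transvectionM s (i j : 'I_s) : {morph transvection i j : p q / p * q}.
Proof. exact: substM. Qed.

Lemma transvection_linear s (i j : 'I_s) : linear (transvection i j).
Proof. exact: subst_linear. Qed.

Lemma parabolic_cases (f : P) :
  (forall k, transvection (lift0 k) i0 f = f) ->
  transvection i0 i1 f = f ->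
  (forall k, transvection (lift0 (lift0 k)) i1 f = f) -> parabolic_invariant f.
Proof.
move=> f0 f1 f2 i j; case: (unliftP ord0 j) => [j'|] -> ij lt_j.
  have jE : j' = ord0 by apply/val_inj; case: j' lt_j {ij} => -[|j'].
  rewrite jE {lt_j} in ij *; case: (unliftP ord0 i) ij => [i'|] -> ij; last exact: f1.
  case: (unliftP ord0 i') ij => [i''|] -> ij; first exact: f2.
  case/negP: ij; exact: eqxx.
case: (unliftP ord0 i) ij => [i'|] -> ij; first exact: f0.
case/negP: ij; exact: eqxx.
Qed.

Lemma dickson2_0_invariant : parabolic_invariant q0.
Proof.
apply: parabolic_cases => [k||k]; rewrite /dickson2_0 transvectionM.
- by rewrite transvectionX_neq ?neq_lift // transvection_dilate.
- rewrite transvectionX_eq dilate_X0 (linD (@transvection_linear _ _ _)).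
  rewrite expr2 !transvectionM transvectionX_eq transvectionX_neq //.
  by apply: (@mod2_eq _ _ (u * v ^+ 2 + v ^+ 3)); ring.
- rewrite transvectionX_neq ?neq_lift // transvection_lift_dilate.
  by rewrite transvectionX_neq ?neq_lift.
Qed.

Lemma dickson2_1_invariant : parabolic_invariant q1.
Proof.
apply: parabolic_cases => [k||k];
  rewrite /dickson2_1 (linD (@transvection_linear _ _ _)) expr2 transvectionM.
- by rewrite transvectionX_neq ?neq_lift // transvection_dilate.
- rewrite transvectionX_eq dilate_X0 (linD (@transvection_linear _ _ _)).
  rewrite expr2 !transvectionM transvectionX_eq transvectionX_neq //.
  by apply: (@mod2_eq _ _ (u * v + v ^+ 2)); ring.
- rewrite transvectionX_neq ?neq_lift // transvection_lift_dilate.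
  by rewrite transvectionX_neq ?neq_lift.
Qed.

Lemma dilate2_invariant (h : {mpoly 'F_2[r]}) : parabolic_invariant (dilate (dilate h)).
Proof.
apply: parabolic_cases => [k||k].
- exact: transvection_dilate.
- rewrite /dilate /transvection !subst_comp; apply: eq_subst => k.
  do ! rewrite ?(substD, substXn, substM, substX) /=.
  set w := 'X_(lift0 (lift0 k)).
  rewrite -[LHS]/((w ^+ 2 + (u + v) * w) ^+ 2 + (v ^+ 2 + (u + v) * v) * (w ^+ 2 + (u + v) * w)).
  apply: (@mod2_eq _ _ ((w ^+ 2 + u * w) * v * w + v ^+ 3 * w + v ^+ 2 * w ^+ 2 + u * v ^+ 2 * w)).
  ring.
- by rewrite transvection_lift_dilate transvection_dilate.
Qed.

Lemma restrictX1 : restrict v = 'X_ord0.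
Proof. exact: restrictX. Qed.

Lemma dickson2_0E : q0 = u * v * (u + v).
Proof. by rewrite /dickson2_0 dilate_X0; ring. Qed.

(** The invariants permute u, v and u + v, so an invariant divisible by one of them
    is divisible by all three. *)
Lemma dickson2_0_dvd (f : P) : parabolic_invariant f -> restrict f = 0 ->
  exists q, f = q0 * q.
Proof.
move=> f_inv f0; have [f1 f1E] := restrict_eq0 f0.
have i01 : i0 != i1 by exact: neq_lift.
have i10 : i1 != i0 by rewrite eq_sym.
have Sf : transposition i0 i1 f = f by rewrite /transposition !f_inv.
have fv : f = v * transposition i0 i1 f1.
  by rewrite -{1}Sf f1E !transpositionE // substM substX eqxx.
have [f2 f2E] : exists f2, transposition i0 i1 f1 = u * f2.
  apply: restrict_eq0; apply: (@mulfI _ ('X_ord0 : {mpoly 'F_2[r.+1]})).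
    exact: var_neq0.
  by rewrite mulr0 -restrictX1 -restrictM -fv.
have fE : f = v * ((u + v) * transvection i0 i1 f2).
  rewrite -{1}(f_inv i0 i1 i01) // fv f2E !transvectionM transvectionX_eq.
  by rewrite transvectionX_neq.
have [f3 f3E] : exists f3, transvection i0 i1 f2 = u * f3.
  apply: restrict_eq0; apply: (@mulfI _ ('X_ord0 ^+ 2 : {mpoly 'F_2[r.+1]})).
    by rewrite expf_neq0 ?var_neq0.
  rewrite mulr0 -f0 fE !restrictM (linD (@restrict_linear _)) restrictX0 restrictX1.
  by rewrite add0r mulrA expr2.
by exists f3; rewrite fE f3E dickson2_0E; ring.
Qed.

Definition dickson_term (f : P) :=
  exists p q (h : {mpoly 'F_2[r]}), f = q0 ^+ p * q1 ^+ q * dilate (dilate h).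

Lemma msize_dickson2_1 : (msize q1 <= 3)%N.
Proof.
rewrite /dickson2_1 -['X_ord0 ^+ 2]scale1r; apply: msize_lin.
  by apply: (msize_exp (m := 1) 2); rewrite msize_var.
by apply: (@msize_dilate _ 1); rewrite msize_var.
Qed.

(** A term v^i St_1 h in one variable fewer has the square q1^i St_2 h at u = 0:
    there q1 becomes v^2, and the outer total power becomes the square. *)
Lemma square_lift n (g : {mpoly 'F_2[r.+1]}) :
  g \in Defs.span (dilate_term n) ->
  exists b : P, [/\ b \in Defs.span dickson_term, restrict b = g ^+ 2,
    parabolic_invariant b & (msize b <= (2 * n).+1)%N].
Proof.
move: g; apply: span_ind.
- exists 0; split; rewrite ?rpred0 ?restrict0 ?expr0n ?msize0 //.
  by move=> i j _ _; rewrite [LHS]subst0.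
- move=> a x y [b [bD bx b_inv le_b]] [c [cD cy c_inv le_c]].
  exists (a *: b + c); split.
  + by apply: rpredD => //; apply: rpredZ.
  + by rewrite restrict_linear bx cy sqrD_mpoly exprZn F2_sqr.
  + by move=> i j ij lt_j; rewrite transvection_linear b_inv // c_inv.
  + exact: msize_lin.
- move=> x [i [h [le_ih ->]]]; exists (q1 ^+ i * dilate (dilate h)); split.
  + by apply: mem_span; exists 0%N, i, h; rewrite expr0 mul1r.
  + rewrite restrictM exprMn restrict_dilate [restrict _]substXn -!/(restrict _).
    rewrite /dickson2_1 (linD (@restrict_linear _)) expr2 restrictM restrictX0.
    by rewrite mul0r add0r restrict_dilate exprAC.
  + move=> k j kj lt_j; rewrite transvectionM dilate2_invariant //.
    by rewrite [transvection _ _ _]substXn -!/(transvection _ _ _) dickson2_1_invariant.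
  + have [h0|h_gt0] := posnP (msize h).
      have -> : h = 0 by apply/eqP; rewrite -msize_poly_eq0 h0.
      by rewrite !dilate0 mulr0 msize0.
    have le_h : (msize h <= (msize h).-1.+1)%N by rewrite prednK.
    apply: leq_trans (msize_mul (msize_exp i msize_dickson2_1)
      (msize_dilate (msize_dilate le_h))) _.
    by move: le_ih; move: (msize h).-1 => d; lia.
Qed.

(** As in [translation_invariant], with q0 in the place of u: the restriction of f
    to u = 0 is a square g^2, where g is invariant under translations by v, so g^2
    lifts to a combination of the required terms.  The difference is divisible by
    u, hence by q0. *)
Lemma dickson_decomposition n (f : P) : (msize f <= n)%N ->
  parabolic_invariant f -> f \in Defs.span dickson_term.
Proof.
elim: n f => [|n IH] f le_f f_inv.
  have -> : f = 0 by apply/eqP; rewrite -msize_poly_eq0 -leqn0.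
  exact: rpred0.
have [|g gE le_g] := @restrict_square _ f.
  by move=> k; apply: f_inv => //; rewrite eq_sym neq_lift.
have g_inv k : transvection (lift0 k) ord0 g = g.
  have ki : lift0 (lift0 k) != i1.
    by rewrite (inj_eq lift_inj) eq_sym; exact: neq_lift.
  apply: sqr_mpoly_inj; rewrite /= -gE -(f_inv _ _ ki isT).
  by rewrite restrict_transvection gE [RHS]substXn.
have le_gm : (msize g <= (msize g).-1.+1)%N by case: (msize g).
have [b [bD bg b_inv le_b]] := square_lift (translation_invariant le_gm g_inv).
have fb_inv : parabolic_invariant (f - b).
  move=> i j ij lt_j; rewrite (linB (@transvection_linear _ _ _)).
  by rewrite f_inv // b_inv.
have [|q qE] := dickson2_0_dvd fb_inv.
  by rewrite (linB (@restrict_linear _)) gE bg subrr.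
have q0_neq0 : q0 != 0.
  rewrite dickson2_0E !mulf_neq0 ?var_neq0 //.
  apply/eqP => /(congr1 (@restrict _)); rewrite restrict0.
  rewrite (linD (@restrict_linear _)) restrictX0 restrictX1 add0r => /eqP.
  by rewrite (negbTE (var_neq0 _)).
have -> : f = b + q0 * q by rewrite -qE addrC subrK.
apply: rpredD => //.
have q_inv : parabolic_invariant q.
  move=> i j ij lt_j; apply: (mulfI q0_neq0).
  by rewrite -{1}(dickson2_0_invariant ij lt_j) -transvectionM -qE fb_inv.
have le_q : (msize q <= n)%N.
  have [->|qn0] := eqVneq q 0; first by rewrite msize0.
  have : (msize (q0 * q) <= n.+1)%N.
    rewrite -qE -scaleN1r addrC; apply: msize_lin => //.
    by apply: leq_trans le_b _; rewrite ltnS; apply: le_g.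
  rewrite /dickson2_0 -mulrA => /msize_var_mul.
  have dn0 : dilate ('X_ord0 : {mpoly 'F_2[r.+1]}) != 0.
    by apply: contraNneq q0_neq0 => d0; rewrite /dickson2_0 d0 mulr0.
  rewrite msizeM //; apply: leq_trans.
  rewrite -subn1 leq_subRL ?addn_gt0; last by rewrite lt0n msize_poly_eq0 dn0.
  by rewrite leq_add2r lt0n msize_poly_eq0.
have := IH q le_q q_inv; move: q {qE q_inv le_q}.
apply: span_ind => [|a x y xD yD|x [i [j [h ->]]]].
- by rewrite mulr0 rpred0.
- by rewrite mulrDr -scalerAr; apply: rpredD => //; apply: rpredZ.
- by apply: mem_span; exists i.+1, j, h; rewrite exprS !mulrA.
Qed.

End Parabolic.

(** * From two variables to the Singer construction *)

Section KeepTwo.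
Context (r : nat).
Local Notation lift0 := (fintype.lift ord0).

Definition keep2 : {mpoly 'F_2[r.+2]} -> {mpoly 'F_2[r.+2]} :=
  subst (fun k => if (k < 2)%N then 'X_k else 0).

Definition constant_term s : {mpoly 'F_2[s]} -> {mpoly 'F_2[s]} :=
  subst (fun _ => 0).

Lemma keep2_linear : linear keep2.
Proof. exact: subst_linear. Qed.

Lemma constant_term_linear s : linear (@constant_term s).
Proof. exact: subst_linear. Qed.

Lemma constant_termM s : {morph @constant_term s : p q / p * q}.
Proof. exact: substM. Qed.

Lemma constant_term1 s : @constant_term s 1 = 1.
Proof. exact: subst1. Qed.

Lemma constant_termX s (i : 'I_s) : constant_term 'X_i = 0.
Proof. exact: substX. Qed.

Lemma keep2Xn p n : keep2 (p ^+ n) = keep2 p ^+ n.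
Proof. exact: substXn. Qed.

Lemma keep2M : {morph keep2 : p q / p * q}.
Proof. exact: substM. Qed.

Lemma keep2X k : keep2 'X_k = if (k < 2)%N then 'X_k else 0.
Proof. exact: substX. Qed.

Lemma keep2_dilate_X0 : keep2 (dilate 'X_ord0) = dilate 'X_ord0.
Proof. by rewrite dilateX (linD keep2_linear) expr2 !keep2M !keep2X. Qed.

Lemma keep2_dickson2_0 : keep2 (dickson2_0 r) = dickson2_0 r.
Proof. by rewrite /dickson2_0 keep2M keep2_dilate_X0 keep2X. Qed.

Lemma keep2_dickson2_1 : keep2 (dickson2_1 r) = dickson2_1 r.
Proof.
by rewrite /dickson2_1 (linD keep2_linear) expr2 keep2M keep2_dilate_X0 keep2X.
Qed.

Lemma keep2_dilate2 (h : {mpoly 'F_2[r]}) :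
  keep2 (dilate (dilate h)) = dilate (dilate (constant_term h)).
Proof.
have dl s := @dilate_linear s; have dM s := @dilateM s.
have kl := keep2_linear; have cl := @constant_term_linear r.
move: h; apply: (@subst_ext _ _ (fun h => keep2 (dilate (dilate h)))
  (fun h => dilate (dilate (constant_term h)))) => [||p q|p q||k].
- exact: lin_comp kl (lin_comp (dl _) (dl _)).
- exact: lin_comp (dl _) (lin_comp (dl _) cl).
- by rewrite !dM keep2M.
- by rewrite [constant_term _]substM !dM.
- by rewrite !dilate1 [keep2 _]subst1 [constant_term _]subst1 !dilate1.
have w0 : keep2 (dilate 'X_(lift0 k)) = 0.
  rewrite dilateX (linD kl) expr2 !keep2M (keep2X (lift0 (lift0 k))).
  by rewrite !mulr0 addr0.
rewrite [constant_term _]substX !(linear_at0 (dl _)).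
rewrite [dilate 'X_k]dilateX (linD (dl _)) dM expr2 dM.
move: w0; move: (dilate 'X_(lift0 k)) => w w0.
by rewrite (linD kl) !keep2M w0 !mulr0 addr0.
Qed.

End KeepTwo.

(** Exchange u with the third variable, which is then set to zero by [keep2]: thus
    [keep2 f] factors through the restriction of f to u = 0. *)
Lemma keep2_square r (f : {mpoly 'F_2[r.+3]}) :
  (forall i j : 'I_r.+3, i != j -> transvection i j f = f) ->
  exists g, keep2 f = g ^+ 2.
Proof.
move=> f_inv; pose i0 : 'I_r.+3 := ord0.
pose i2 : 'I_r.+3 := fintype.lift ord0 (fintype.lift ord0 ord0).
have i02 : i0 != i2 by exact: neq_lift.
have i20 : i2 != i0 by rewrite eq_sym.
have Sf : transposition i0 i2 f = f by rewrite /transposition !f_inv.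
have [|g gE _] := @restrict_square _ f.
  by move=> k; apply: f_inv; rewrite eq_sym; exact: neq_lift.
pose K k : {mpoly 'F_2[r.+3]} :=
  keep2 (if k == i0 then 'X_i2 else if k == i2 then 'X_i0 else 'X_k).
exists (subst (fun k => K (fintype.lift ord0 k)) g).
have -> : keep2 f = subst K f.
  by rewrite -{1}Sf (transpositionE f i02); exact: subst_comp.
rewrite -substXn -gE; symmetry; apply: (etrans (subst_comp _ _ _)).
apply: eq_subst => k; case: (unliftP ord0 k) => [l|] ->; first exact: substX.
rewrite (linear_at0 (@subst_linear _ _ _)) /K eqxx keep2X.
by [].
Qed.

(* Unification would otherwise unfold substitutions down to the representation of
   polynomials. *)
Local Opaque dilate constant_term keep2 total_power.

Section Assembly.
Context (M : unstableModType) (N : tensor_tower M).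

Lemma gr0_act s (h : {mpoly 'F_2[s]}) (t : level N s) :
  gr 0 (h • t) = constant_term h • gr 0 t.
Proof.
elim/mpoly_lin_ind: h => [a p q IH IH'||i m IH].
- by rewrite act_linearl gr_is_linear IH IH' constant_term_linear act_linearl.
- by rewrite constant_term1 !act1.
- rewrite actM gr_var0 constant_termM constant_termX mul0r.
  by rewrite (linear_at0 (@act_linearl _ _ _ _)).
Qed.

Lemma gr0_hits s (t : level N s) : t \in hits -> gr 0 t = 0.
Proof.
move: t; apply: span_ind => [|a x y x0 y0|_ [I [x [I_gt0 ->]]]].
- exact: linear_at0 (gr_is_linear _).
- by rewrite gr_is_linear x0 y0 scaler0 addr0.
elim: I I_gt0 => // k I IH; rewrite /= => I_gt0; set y := foldr _ _ _ in IH *.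
have [K yE] := gr_fin y; case: k I_gt0 => [|k] I_gt0; first by rewrite Sq0_id IH.
rewrite {1}yE (lin_sum (Sq_is_linear _)) (lin_sum (gr_is_linear _)) big1 // => n _.
by rewrite (gr_hom 0 (homogeneous_Sq k.+1 (homogeneous_gr n y))) addnS.
Qed.

(** Multiplying by one variable at a time, the first term of [Sq_varS] vanishes by
    instability. *)
Lemma Sq_monomial s (m : 'X_{1..s}) (t : level N s) : homogeneous 0 t ->
  Sq (mdeg m) ('X_[m] • t) = 'X_[m] ^+ 2 • t /\
  homogeneous (mdeg m) ('X_[m] • t).
Proof.
move=> t0; elim/monomial_ind: m => [|m i [IH mt]].
  by rewrite mdeg0 mpolyX0 expr1n act1 Sq0_id.
rewrite mdegD mdeg1 add1n mpolyXD actM; split; last exact: homogeneous_var.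
rewrite Sq_varS (Sq_hom_eq0 mt) // (linear_at0 (act_linear _)) add0r IH.
by rewrite exprMn [RHS]actM.
Qed.

(** A conclusion stable under linear combinations, whether or not the terms are
    homogeneous. *)
Definition hit_mod_degree0 s (t : level N s) := t - gr 0 t \in hits.

Lemma hit_mod_degree0_lin s a (t t' : level N s) :
  hit_mod_degree0 t -> hit_mod_degree0 t' -> hit_mod_degree0 (a *: t + t').
Proof.
rewrite /hit_mod_degree0 gr_is_linear opprD addrACA -scalerBr => ht ht'.
by apply: rpredD => //; apply: rpredZ.
Qed.

Lemma hit_mod_degree0_hit s (t : level N s) : t \in hits -> hit_mod_degree0 t.
Proof. by move=> ht; rewrite /hit_mod_degree0 gr0_hits // subr0. Qed.

Lemma square_degree0 s (g : {mpoly 'F_2[s]}) (t : level N s) :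
  homogeneous 0 t -> hit_mod_degree0 (g ^+ 2 • t).
Proof.
move=> t0; elim/mpoly_lin_ind: g => [a p q IH IH'||i m _].
- rewrite sqrD_mpoly exprZn F2_sqr act_linearl.
  exact: hit_mod_degree0_lin.
- by rewrite expr1n act1 /hit_mod_degree0 t0 subrr rpred0.
- rewrite -mpolyXD; have [<- _] := Sq_monomial (U_(i) + m)%MM t0.
  by apply: hit_mod_degree0_hit; apply: Sq_hit; rewrite mdegD mdeg1.
Qed.

(** On q0^p q1^q St_2 h the assertion says that q0^p q1^q St_2 y is hit for
    y = h z - gr 0 (h z): the degree 0 part of h z involves only the constant term
    of h, and that is what [keep2] retains of St_2 h. *)
Lemma dickson_span_hit r (b : {mpoly 'F_2[r.+2]}) (z : level N r) :
  b \in Defs.span (@dickson_term r) ->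
  b • total_power (total_power z) -
    keep2 b • total_power (total_power (gr 0 z)) \in hits.
Proof.
have tl s := @total_power_linear M N s.
move: b; apply: span_ind => [|a x y hx hy|_ [p [q [h ->]]]].
- rewrite (linear_at0 (@keep2_linear r)) !(linear_at0 (@act_linearl _ _ _ _)) subrr.
  exact: rpred0.
- rewrite keep2_linear !act_linearl opprD addrACA -scalerBr.
  apply: rpredD; last exact: hy.
  by apply: rpredZ; exact: hx.
set d := _ ^+ p * _ ^+ q.
have keep2_d : keep2 d = d.
  by rewrite /d keep2M !keep2Xn keep2_dickson2_0 keep2_dickson2_1.
have d_hit n (y : level N r) : (0 < n)%N -> homogeneous n y ->
    d • total_power (total_power y) \in hits by exact: dickson2_pow_hit.
have -> : keep2 (d * dilate (dilate h)) = d * dilate (dilate (constant_term h)).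
  exact: etrans (keep2M _ _) (congr2 *%R keep2_d (keep2_dilate2 h)).
move: d {keep2_d} d_hit => d d_hit.
have dE (h' : {mpoly 'F_2[r]}) (y : level N r) : (d * dilate (dilate h')) •
    total_power (total_power y) = d • total_power (total_power (h' • y)).
  by rewrite actM -!total_power_act.
rewrite [X in X - _ \in _]dE [X in _ - X \in _]dE.
rewrite -gr0_act; have [K zE] := gr_fin (h • z).
have Dl : linear (fun y : level N r => d • total_power (total_power y)).
  exact: lin_comp (act_linear _) (lin_comp (tl _) (tl _)).
move: (h • z) zE => y yE; rewrite -[X in X \in _](linB Dl).
have -> : y - gr 0 y = \sum_(n < K | n != 0%N :> nat) gr n y.
  case: K yE => [|K] yE; first by rewrite yE !big_ord0 (linear_at0 (gr_is_linear _)) subrr.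
  rewrite {1}yE (bigD1 ord0) //= [LHS]addrAC subrr add0r.
  by apply: eq_bigl => n.
rewrite (lin_sum Dl); apply: rpred_sum => n n0.
by apply: d_hit (homogeneous_gr n y); rewrite lt0n.
Qed.

Fixpoint tower_power s (x : M) : level N s :=
  match s with
  | 0 => pure N 1 x
  | s'.+1 => total_power (tower_power s' x)
  end.

(** What [dickson_span_hit] leaves is a square times a class of degree 0. *)
Lemma dickson_power_hit r (f : {mpoly 'F_2[r.+3]}) (x : M) :
  f \in dickson r.+3 -> hit_mod_degree0 (f • tower_power r.+3 x).
Proof.
move=> fD; have f_inv i j : i != j -> transvection i j f = f.
  exact: dickson_transvection.
have [g gE] := keep2_square f_inv.
have f_span : f \in Defs.span (@dickson_term r.+1).
  by apply: (@dickson_decomposition _ (msize f)) => // i j ij _; exact: f_inv.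
have := dickson_span_hit (tower_power r.+1 x) f_span; rewrite gE.
set t := total_power (total_power (gr 0 _)) => F_t.
have t0 : homogeneous 0 t.
  apply: (@homogeneous_total_power _ _ _ 0); apply: (@homogeneous_total_power _ _ _ 0).
  exact: homogeneous_gr.
have -> : f • tower_power r.+3 x = 1 *: (f • tower_power r.+3 x - g ^+ 2 • t) + g ^+ 2 • t.
  by rewrite scale1r subrK.
apply: hit_mod_degree0_lin; last exact: square_degree0.
exact: hit_mod_degree0_hit.
Qed.

End Assembly.

Lemma lin_St1 (V : sqModType) (W : lmodType 'F_2) (f : {mpoly 'F_2[1]} ⊗ V -> W)
  (x : V) : linear f ->
  f (St1 x) =
  \sum_(n < gr_bound x) \sum_(i < n.+1) f ('X_ord0 ^+ (n - i) *t Sq i (gr n x)).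
Proof.
move=> fl; rewrite /St1 (lin_sum fl); apply: eq_bigr => n _.
by rewrite (lin_sum fl).
Qed.

Section MergeTensors.
Context (M : sqModType) (s : nat).
Local Notation N := (tensors M).

Lemma first_var_linear : linear (@first_var s).
Proof. by move=> a p q; rewrite /first_var linearP. Qed.

Lemma first_varXn k : first_var s ('X_ord0 ^+ k) = 'X_ord0 ^+ k.
Proof. by rewrite /first_var rmorphXn /= comp_mpolyXU -tnth_nth tnth_mktuple. Qed.

Lemma merge_bilinear : is_bilinear (fun (p : {mpoly 'F_2[1]}) (t : level N s) =>
  (first_var s p • shift t : level N s.+1)).
Proof.
split=> [x a p q|p a x y]; first by rewrite first_var_linear act_linearl.
by rewrite shift_linear act_linear.
Qed.

Lemma merge_tlift : @Defs.merge s M = tlift (fun (p : {mpoly 'F_2[1]})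
  (t : level N s) => (first_var s p • shift t : level N s.+1)).
Proof.
rewrite /Defs.merge; congr tlift; apply: funext => p; apply: funext => t.
have bil : is_bilinear (fun q (m : M) => (first_var s p * last_vars q) *t m).
  split=> [x a q q'|q a x y]; last exact: (@tensor_pure_linearr M).
  by rewrite [last_vars _]subst_linear mulrDr -scalerAr (@tensor_pure_linearl M).
elim/(@tensor_level_ind M): t => [a t t' IH IH'|q x].
  by rewrite (tlift_linear bil) IH IH' shift_linear act_linear.
by rewrite (tliftE _ _ bil); rewrite -[RHS]/(poly_act _ (tensor_shift _)) tensor_shiftE poly_actE.
Qed.

Lemma merge_linear : linear (@Defs.merge s M).
Proof. rewrite merge_tlift; exact: tlift_linear merge_bilinear. Qed.

Lemma merge_pure (p : {mpoly 'F_2[1]}) (t : level N s) :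
  Defs.merge (p *t t) = (first_var s p • shift t : level N s.+1).
Proof. by rewrite merge_tlift (tliftE _ _ merge_bilinear). Qed.

Lemma merge_St1 (t : level N s) : Defs.merge (St1 t) = total_power t.
Proof.
have ml := merge_linear; apply: (etrans (lin_St1 t ml)).
apply: eq_bigr => n _; apply: eq_bigr => i _.
by rewrite merge_pure first_varXn.
Qed.

End MergeTensors.

Lemma St_tower_power (M : unstableModType) s (x : M) :
  St s x = tower_power (tensors M) s x.
Proof. by elim: s => [//|s IH] /=; rewrite IH merge_St1. Qed.

Lemma singer_hit_mod_degree0 s (M : unstableModType) (z : {mpoly 'F_2[s]} ⊗ M) :
  (2 < s)%N -> z \in singer s M -> hit_mod_degree0 (N := tensors M) z.
Proof.
case: s z => [|[|[|r]]] // z _ /asboolP[l [lD ->]].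
elim: l lD => [|y l IH] lD.
  by rewrite big_nil /hit_mod_degree0 (linear_at0 (gr_is_linear _)) subrr rpred0.
rewrite big_cons -[poly_act _ _]scale1r.
apply: (@hit_mod_degree0_lin _ (tensors M)).
  rewrite St_tower_power; apply: (@dickson_power_hit _ (tensors M)).
  by apply: lD; rewrite mem_head.
by apply: IH => w wl; apply: lD; rewrite inE wl orbT.
Qed.

Theorem theorem1 (s : nat) (hs : (2 < s)%N) (M : unstableModType)
    (z : {z : {mpoly 'F_2[s]} ⊗ M | z \in singer s M})
    (d : nat) (hd : (0 < d)%N) (hz : homogeneous d (sval z)) :
  singer_to_indec z = 0.
Proof.
have z_hit := singer_hit_mod_degree0 hs (svalP z).
rewrite /singer_to_indec /indec_proj; apply/eqP.
rewrite -[0](linear0 (quot_pi (@decomposable _))) quot_piE subr0.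
move: z_hit; rewrite /hit_mod_degree0 (gr_hom 0 hz) eq_sym gtn_eqF // subr0.
by [].
Qed.
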